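(* Let $K=\mathbb{R}$ or $K=\mathbb{C}$. Let $f\in K(z)$ be a rational map of degree $d\geq 2$, and fix a homogeneous lift $F$ of $f$. Then the function $R_F:\mathfrak{h}_K\to\mathbb{R}$ is smooth, proper, and subharmonic with respect to the hyperbolic Laplacian (that is, $\Delta_h R_F\ge 0$). In particular, $R_F$ attains a minimum on $\mathfrak{h}_K$.
   Context: $K^2$ carries the Euclidean norm $\|(X,Y)\|=\sqrt{|X|^2+|Y|^2}$; $\mathrm{SU}_2(K)$ denotes $\mathrm{SO}(2)$ if $K=\mathbb{R}$ and $\mathrm{SU}(2)$ if $K=\mathbb{C}$. A homogeneous lift of $f$ is a map $F=(F_0,F_1):K^2\to K^2$ with $F_0,F_1\in K[X,Y]$ coprime, homogeneous of degree $d$, and $f(z)=F_0(z,1)/F_1(z,1)$. For $\gamma\in \mathrm{SL}_2(K)$ put $F^\gamma(v)=\gamma^{-1}\cdot F(\gamma\cdot v)$. Let $S_K$ be the unit sphere of $K^2$ and $\sigma_K$ its rotation-invariant probability measure; set $R(F)=\int_{S_K}\log\|F(v)\|\,d\sigma_K(v)$ and $R_F([\gamma]):=R(F^\gamma)$, which is a well-defined function on $\mathrm{SL}_2(K)/\mathrm{SU}_2(K)$. $\mathfrak{h}_K=\mathrm{SL}_2(K)/\mathrm{SU}_2(K)$ is identified with the upper half-space model $\mathbb{H}_K=\{(z,t): z\in K,\ t>0\}$ of real hyperbolic $([K:\mathbb{R}]+1)$-space as follows: every class $[\gamma]$ has a unique representative $\gamma_{z,t}=\begin{pmatrix}\sqrt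 t & z/\sqrt t\\ 0&1/\sqrt t\end{pmatrix}$ with $z\in K$, $t>0$, and $[\gamma_{z,t}]$ corresponds to $(z,t)$. The hyperbolic Laplacian is $\Delta_h=t^2\Delta_{\mathrm{std}}$ if $K=\mathbb{R}$ and $\Delta_h=t^2\Delta_{\mathrm{std}}-t\,\partial/\partial t$ if $K=\mathbb{C}$, where $\Delta_{\mathrm{std}}$ is the Euclidean Laplacian on $\mathbb{R}^{[K:\mathbb{R}]+1}$. *)

(* Defs.v *)
From HB Require Import structures.
From mathcomp Require Import all_boot all_order all_algebra.
From mathcomp Require Import fraction complex.
From mathcomp Require Import all_classical all_reals all_analysis.
From mathcomp Require mpoly.
From mathcomp Require Import -(notations) mpoly.

Set Implicit Arguments.
Unset Strict Implicit.
Unset Printing Implicit Defensive.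

Import Order.TTheory GRing.Theory Num.Theory.
Import numFieldNormedType.Exports.

Local Open Scope classical_set_scope.
Local Open Scope ring_scope.

(* The choice K = R or K = C. *)
Variant base := RealBase | ComplexBase.

Section Base.
Variable R : realType.

Definition Kfield (k : base) : numFieldType :=
  match k with RealBase => R | ComplexBase => R[i] end.

(* [K : R] *)
Definition Kdeg (k : base) : nat :=
  match k with RealBase => 1 | ComplexBase => 2 end.

Definition Kreal (k : base) : R -> Kfield k :=
  match k with RealBase => fun x => x | ComplexBase => real_complex R end.

Definition Kconj (k : base) : Kfield k -> Kfield k :=
  match k with RealBase => fun x => x | ComplexBase => @conjc R end.

(* On R[i] the library norm `|z| takes values in R[i]; this is its real part. *)
Definition Kabs (k : base) : Kfield k -> R :=
  match k with
  | RealBase => fun x => `|x|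
  | ComplexBase => fun z => complex.Re `|z|
  end.

(* The Euclidean coordinates of (z, t) in K x R are (z, t) if K = R and
   (Re z, Im z, t) if K = C. *)
Definition zcoord (k : base) : 'rV[R]_(Kdeg k).+1 -> Kfield k :=
  match k with
  | RealBase => fun p : 'rV[R]_2 => p 0 0
  | ComplexBase => fun p : 'rV[R]_3 => (p 0 0 +i* p 0 1)%C
  end.

Definition tcoord (k : base) (p : 'rV[R]_(Kdeg k).+1) : R := p 0 ord_max.

Definition upper_half (k : base) : set 'rV[R]_(Kdeg k).+1 :=
  [set p | 0 < tcoord p].

End Base.

Section Lift.
Variable K : fieldType.

Definition has_degree (f : {fraction {poly K}}) (d : nat) : Prop :=
  exists p q : {poly K}, [/\ coprimep p q, q != 0,
    f = tofrac p / tofrac q & d = maxn (size p).-1 (size q).-1].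

(* K[X, Y], with X and Y the variables of index 0 and 1. *)
Definition bipoly := mpoly 2 K.

Definition coprime_bipoly (F0 F1 : bipoly) : Prop :=
  forall G H0 H1 : bipoly, F0 = G * H0 -> F1 = G * H1 -> G \is a GRing.unit.

Definition dehomog (P : bipoly) : {poly K} :=
  mmap polyC (fun i : 'I_2 => if i == 0 then 'X else 1) P.

Definition homogeneous_lift (f : {fraction {poly K}}) (d : nat)
    (F : bipoly * bipoly) : Prop :=
  [/\ F.1 \is ishomog1 d mdeg, F.2 \is ishomog1 d mdeg,
      coprime_bipoly F.1 F.2 &
      f = tofrac (dehomog F.1) / tofrac (dehomog F.2)].

Definition lift_map (F : bipoly * bipoly) (v : 'cV[K]_2) : 'cV[K]_2 :=
  \col_i meval (fun j => v j 0) (if i == 0 then F.1 else F.2).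

Definition SL2 : set 'M[K]_2 := [set g | \det g = 1].

Definition conj_map (g : 'M[K]_2) (G : 'cV[K]_2 -> 'cV[K]_2) :
    'cV[K]_2 -> 'cV[K]_2 :=
  fun v => invmx g *m G (g *m v).

End Lift.

Section HyperbolicSpace.
Variables (R : realType) (k : base).
Local Notation K := (Kfield R k).
Local Notation n := (Kdeg k).+1.

Definition SU2 : set 'M[K]_2 :=
  [set u | \det u = 1 /\ (map_mx (@Kconj R k) u)^T *m u = 1%:M].

Definition enorm (v : 'cV[K]_2) : R :=
  Num.sqrt (Kabs (v 0 0) ^+ 2 + Kabs (v 1 0) ^+ 2).

Definition Ksphere : set 'cV[K]_2 := [set v | enorm v = 1].

Definition Kborel : measurableType (sigma_display (@open 'cV[K]_2)) :=
  g_sigma_algebraType (@open 'cV[K]_2).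

(* SU2 acts transitively on the sphere, so these conditions determine sigma. *)
Definition rotation_invariant (sigma : probability Kborel R) : Prop :=
  sigma Ksphere = 1%E /\
  forall (u : 'M[K]_2) (A : set Kborel), SU2 u -> measurable A ->
    sigma ((fun v : 'cV[K]_2 => u *m v) @^-1` A) = sigma A.

Definition sphere_mean (sigma : probability Kborel R)
    (G : 'cV[K]_2 -> 'cV[K]_2) : R :=
  (\int[sigma]_(v in Ksphere) ln (enorm (G v)))%R.

Definition SU2_coset (g : 'M[K]_2) : set 'M[K]_2 := [set g *m u | u in SU2].

(* SL2 / SU2 *)
Definition hspace : set (set 'M[K]_2) := [set SU2_coset g | g in @SL2 K].

(* For c = SU2_coset g this is the sphere mean of F^g: the value does not depend
   on the representative of c when sigma is rotation invariant. *)
Definition RF (sigma : probability Kborel R) (F : bipoly K * bipoly K)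
    (c : set 'M[K]_2) : R :=
  sphere_mean sigma (conj_map (xget 1%:M c) (lift_map F)).

Definition gamma_mx (p : 'rV[R]_n) : 'M[K]_2 :=
  let s := Kreal k (Num.sqrt (tcoord p)) in
  \matrix_(i, j)
    (if i == 0 then (if j == 0 then s else zcoord p / s)
     else (if j == 0 then 0 else s^-1)).

Definition RF_coord (sigma : probability Kborel R) (F : bipoly K * bipoly K)
    (p : 'rV[R]_n) : R :=
  RF sigma F (SU2_coset (gamma_mx p)).

End HyperbolicSpace.

Section Calculus.
Variables (R : realType) (m : nat).
Implicit Types (g : 'rV[R]_m.+1 -> R) (U : set 'rV[R]_m.+1).

Definition partial (i : 'I_m.+1) g : 'rV[R]_m.+1 -> R :=
  fun x => 'D_(delta_mx 0 i) g x.

Definition partials (s : seq 'I_m.+1) g := foldr partial g s.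

(* C^oo on an open set U: the iterated partial derivatives of all orders exist
   and are continuous on U. *)
Definition smooth_on U g : Prop :=
  forall s : seq 'I_m.+1, forall x, U x ->
    {for x, continuous (partials s g)} /\
    forall i, derivable (partials s g) x (delta_mx 0 i).

Definition laplacian g (x : 'rV[R]_m.+1) : R :=
  \sum_(i < m.+1) partials [:: i; i] g x.

Definition proper_on U g : Prop :=
  forall A : set R, compact A -> compact (U `&` g @^-1` A).

End Calculus.

Definition hyp_laplacian (R : realType) (k : base)
    (g : 'rV[R]_(Kdeg k).+1 -> R) (p : 'rV[R]_(Kdeg k).+1) : R :=
  match k with
  | RealBase => tcoord p ^+ 2 * laplacian g p
  | ComplexBase =>
      tcoord p ^+ 2 * laplacian g p - tcoord p * partial ord_max g p
  end.

(* Main.v *)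
Require Import Defs.
From mathcomp Require Import all_boot all_order all_algebra.
From mathcomp Require Import fraction complex ring lra.
From mathcomp Require Import all_classical all_reals all_analysis.
From mathcomp Require mpoly.
From mathcomp Require Import -(notations) mpoly.

Set Implicit Arguments.
Unset Strict Implicit.
Unset Printing Implicit Defensive.

Import Order.TTheory GRing.Theory Num.Theory.
Import numFieldNormedType.Exports.

Local Open Scope classical_set_scope.
Local Open Scope ring_scope.

(* Write gamma for the matrix of the point p = (z, t), kappa for [K : R], and
   b_p(w) = log |gamma^-1 w|. The rotation invariant measure transforms under
   gamma by the Poisson kernel exp (-2 kappa b_p): functions on K^2 \ {0} that
   are homogeneous of degree -2 kappa have SL_2(K)-invariant integrals over the
   sphere. Infinitesimally this is an integration by parts, in which a traceless
   linear field is split on the sphere into its radial part, controlled by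
   Euler's identity, and a combination of infinitesimal rotations. Hence
     R_F(p) = int (b_p(F w) - d b_p(w)) exp (-2 kappa b_p(w)) dsigma(w).
   In 2 b_p one recognizes, up to a constant, a Busemann function: its gradient
   has norm 1 and its hyperbolic Laplacian is kappa, so exp (-2 kappa b_p(w)) is
   harmonic, and by Cauchy-Schwarz the Laplacian of the integrand is at least
   (d - 1) kappa / 2 times the Poisson kernel. Smoothness is differentiation
   under the integral. For properness, |gamma^-1 y| >= |y| / rho with rho the
   Hilbert-Schmidt norm of gamma, so R_F(p) >= d int log |gamma w| - log rho - C,
   and int log |gamma w| >= (3/5) log rho - C' by averaging over five rotations,
   at most one of which brings w close to the contracted direction. *)

(** * Formal expressions *)

(* All integrands are evaluations of such expressions, so that iterated
   derivatives stay in the class and are computed by a derivation of the syntax. *)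
Section Expressions.
Variable R : realType.

(** In R(F^gamma) as defined, gamma sits inside F, so derivatives in p would bring in those of F.
    After the substitution w = gamma v, p enters only through b_p at w and at F w, and F is never
    differentiated. The summand - d b_p(w) is 0 at w = gamma v with v on the sphere, where |gamma^-1
    w| = 1, so it changes nothing there; its purpose is to make the logarithmic factor homogeneous
    of degree 0 and the whole integrand homogeneous of degree -2 kappa, as the substitution
    requires. Since sigma is given only by its rotation invariance, no Jacobian is computed:
    triangular matrices are joined to 1 by flows along which the mean has derivative zero. Five is
    the least number of rotations that works. Among n rotations the bad one costs log rho and each
    other one gains log rho, so the mean is about ((n - 2) / n) log rho. To beat the loss log rho
    already for d = 2 one needs 2 (n - 2) / n > 1, that is n > 4. *)

Inductive expr :=
| Cst of R | Var of nat | Add of expr & expr | Mul of expr & expr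
| Inv of expr | Ln of expr.

Fixpoint ev (r : nat -> R) (e : expr) : R :=
  match e with
  | Cst c => c
  | Var i => r i
  | Add a b => ev r a + ev r b
  | Mul a b => ev r a * ev r b
  | Inv a => (ev r a)^-1
  | Ln a => ln (ev r a)
  end.

(** Excludes the default values of the inverse at 0 and of [ln] on nonpositive numbers. Where it
    holds, evaluation is smooth in the variables; it is an open condition and is stable under
    [dv]. *)
Fixpoint wf (r : nat -> R) (e : expr) : Prop :=
  match e with
  | Cst _ | Var _ => True
  | Add a b | Mul a b => wf r a /\ wf r b
  | Inv a => wf r a /\ ev r a != 0
  | Ln a => wf r a /\ 0 < ev r a
  end.

Definition Opp e := Mul (Cst (-1)) e.

(* The derivation of the expression ring along the vector field sending the
   i-th variable to d i. *)
Fixpoint dv (d : nat -> expr) (e : expr) : expr :=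
  match e with
  | Cst _ => Cst 0
  | Var i => d i
  | Add a b => Add (dv d a) (dv d b)
  | Mul a b => Add (Mul (dv d a) b) (Mul a (dv d b))
  | Inv a => Opp (Mul (dv d a) (Inv (Mul a a)))
  | Ln a => Mul (dv d a) (Inv a)
  end.

Fixpoint sub (f : nat -> expr) (e : expr) : expr :=
  match e with
  | Cst c => Cst c
  | Var i => f i
  | Add a b => Add (sub f a) (sub f b)
  | Mul a b => Mul (sub f a) (sub f b)
  | Inv a => Inv (sub f a)
  | Ln a => Ln (sub f a)
  end.

Lemma ev_sub r f e : ev r (sub f e) = ev (fun i => ev r (f i)) e.
Proof. by elim: e => //= [a -> b ->|a -> b ->|a ->|a ->]. Qed.

Lemma wf_sub r f e : (forall i, wf r (f i)) ->
  wf (fun i => ev r (f i)) e -> wf r (sub f e).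
Proof.
move=> wff; elim: e => //=.
- by move=> a IHa b IHb [/IHa ? /IHb].
- by move=> a IHa b IHb [/IHa ? /IHb].
- by move=> a IHa [/IHa ?]; rewrite ev_sub.
- by move=> a IHa [/IHa ?]; rewrite ev_sub.
Qed.

Lemma eq_ev r1 r2 e : r1 =1 r2 -> ev r1 e = ev r2 e.
Proof. by move=> r12; elim: e => //= [a -> b ->|a -> b ->|a ->|a ->]. Qed.

Lemma eq_wf r1 r2 e : r1 =1 r2 -> wf r1 e -> wf r2 e.
Proof.
move=> r12; elim: e => //=.
- by move=> a IHa b IHb [/IHa ? /IHb].
- by move=> a IHa b IHb [/IHa ? /IHb].
- by move=> a IHa [/IHa ?]; rewrite (eq_ev _ r12).
- by move=> a IHa [/IHa ?]; rewrite (eq_ev _ r12).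
Qed.

Lemma wf_dv r d e : (forall i, wf r (d i)) -> wf r e -> wf r (dv d e).
Proof.
move=> wfd; elim: e => //=.
- by move=> a IHa b IHb [/IHa ? /IHb].
- by move=> a IHa b IHb [wa wb]; split; split=> //; [exact: IHa|exact: IHb].
- by move=> a IHa [wa a0]; do !split=> //; [exact: IHa|rewrite mulf_neq0].
- by move=> a IHa [wa a0]; do !split=> //; [exact: IHa|rewrite gt_eqF].
Qed.

Lemma ev_continuous (T : topologicalType) (r : T -> nat -> R) t e :
  (forall i, {for t, continuous (fun s => r s i)}) -> wf (r t) e ->
  {for t, continuous (fun s => ev (r s) e)}.
Proof.
move=> cr; elim: e => //=.
- by move=> c _; exact: cvg_cst.
- by move=> a IHa b IHb [/IHa ca /IHb cb]; exact: cvgD.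
- by move=> a IHa b IHb [/IHa ca /IHb cb]; exact: cvgM.
- by move=> a IHa [/IHa ca a0]; exact: (cvgV a0 ca).
- move=> a IHa [/IHa ca a0]; apply: (@continuous_comp _ _ _ (fun s =>
    ev (r s) a) (@ln R)) => //.
  exact: continuous_ln.
Qed.

Lemma wf_near (T : topologicalType) (r : T -> nat -> R) t e :
  (forall i, {for t, continuous (fun s => r s i)}) -> wf (r t) e ->
  \forall s \near t, wf (r s) e.
Proof.
move=> cr; elim: e => //=.
- by move=> c _; exact: filterT.
- by move=> c _; exact: filterT.
- by move=> a IHa b IHb [/IHa ca /IHb cb]; exact: filterI.
- by move=> a IHa b IHb [/IHa ca /IHb cb]; exact: filterI.
- move=> a IHa [wa a0]; apply: filterI; first exact: IHa.
  have : nbhs (ev (r t) a) [set x : R | x != 0].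
    by apply: open_nbhs_nbhs; split=> //; exact: open_neq.
  exact: (ev_continuous cr wa).
- move=> a IHa [wa a0]; apply: filterI; first exact: IHa.
  have : nbhs (ev (r t) a) [set x : R | 0 < x].
    by apply: open_nbhs_nbhs; split=> //; exact: open_gt.
  exact: (ev_continuous cr wa).
Qed.

Lemma is_derive_ev (r : R -> nat -> R) (d : nat -> expr) (s : R) e :
  (forall i, is_derive s 1 (fun u => r u i) (ev (r s) (d i))) ->
  wf (r s) e -> is_derive s 1 (fun u => ev (r u) e) (ev (r s) (dv d e)).
Proof.
move=> dr; elim: e => //=.
- by move=> c _; exact: is_derive_cst.
- by move=> a IHa b IHb [/IHa ca /IHb cb]; exact: is_deriveD.
- move=> a IHa b IHb [/IHa ca /IHb cb].
  apply: (is_derive_eq (is_deriveM ca cb)).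
  by rewrite /GRing.scale /=; ring.
- move=> a IHa [/IHa ca a0].
  apply: (is_derive_eq (is_deriveV a0 ca)).
  by rewrite /GRing.scale /= -expr2; field.
- move=> a IHa [/IHa ca a0].
  apply: (is_derive_eq (is_derive1_comp (is_derive1_ln a0) ca)).
  by rewrite mulrC.
Qed.

Lemma measurable_ev d (T : measurableType d) (r : T -> nat -> R) e :
  (forall i, measurable_fun setT (fun t => r t i)) ->
  measurable_fun setT (fun t => ev (r t) e).
Proof.
move=> mr; elim: e => //=.
- by move=> a IHa b IHb; exact: measurable_realfun.measurable_funD.
- by move=> a IHa b IHb; exact: measurable_realfun.measurable_funM.
- move=> a IHa.
  (* Inversion is measurable through x^-1 = x exp(- ln(x^2)), which holds at x = 0 too, both sides
     being 0 there. *)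
  have -> : (fun t => (ev (r t) a)^-1) =
      (fun t => ev (r t) a * expR (- ln (ev (r t) a * ev (r t) a))).
    apply/funext => t; have [->|a0] := eqVneq (ev (r t) a) 0.
      by rewrite invr0 mul0r.
    rewrite expRN lnK ?invfM ?mulVKf//.
    by rewrite posrE -expr2 exprn_even_gt0.
  apply: measurable_realfun.measurable_funM => //; apply: measurableT_comp => //.
  apply: measurableT_comp => //; apply: measurableT_comp => //.
  exact: measurable_realfun.measurable_funM.
- by move=> a IHa; apply: measurableT_comp.
Qed.

End Expressions.

Lemma mulmx2E (K : pzRingType) m p (g : 'M[K]_(m, 2)) (h : 'M[K]_(2, p)) i j :
  (g *m h) i j = g i 0 * h 0 j + g i 1 * h 1 j.
Proof.
rewrite mxE !big_ord_recl big_ord0 addr0.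
by rewrite (_ : lift ord0 ord0 = 1)//; exact/val_inj.
Qed.

Lemma continuous_to_mx (T : topologicalType) (U : topologicalType) m n
    (f : T -> 'M[U]_(m, n)) (t : T) :
  (forall i j, {for t, continuous (fun s => f s i j)}) ->
  {for t, continuous f}.
Proof.
move=> cf A [P nP PA].
have : \forall s \near t, forall ij : 'I_m * 'I_n, P ij.1 ij.2 (f s ij.1 ij.2).
  by apply: filter_forall => -[i j]; apply: (cf i j); exact: nP.
by apply: filterS => s Ps; apply: PA => i j; exact: (Ps (i, j)).
Qed.

(** * Coordinates and the sphere *)

(* For K = R the imaginary part is 0 and Kmk drops its second argument: K^2 is
   then the slice x_1 = x_3 = 0 of the coordinates xv below. *)
Section Coordinates.
Variables (R : realType) (k : base).
Local Notation K := (Kfield R k).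

Definition Kre : K -> R :=
  match k return Kfield R k -> R with
  | RealBase => fun x => x | ComplexBase => @complex.Re R end.

Definition Kim : K -> R :=
  match k return Kfield R k -> R with
  | RealBase => fun=> 0 | ComplexBase => @complex.Im R end.

Definition Kmk : R -> R -> K :=
  match k return R -> R -> Kfield R k with
  | RealBase => fun a _ => a | ComplexBase => fun a b => (a +i* b)%C end.

End Coordinates.

Section CoordinatesTheory.
Variables (R : realType) (k : base).
Local Notation K := (Kfield R k).
Implicit Types x y : K.

Lemma KreD x y : Kre (x + y) = Kre x + Kre y.
Proof. by case: k x y => //= -[a b] [c d]. Qed.
Lemma KimD x y : Kim (x + y) = Kim x + Kim y.
Proof. by case: k x y => /= [a b|[a b] [c d]//]; rewrite addr0. Qed.
Lemma KreM x y : Kre (x * y) = Kre x * Kre y - Kim x * Kim y.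
Proof. by case: k x y => /= [a b|[a b] [c d]//]; rewrite mulr0 subr0. Qed.
Lemma KimM x y : Kim (x * y) = Kre x * Kim y + Kim x * Kre y.
Proof. by case: k x y => /= [a b|[a b] [c d]//]; rewrite mulr0 mul0r addr0. Qed.
Lemma KreN x : Kre (- x) = - Kre x.
Proof. by case: k x => //= -[a b]. Qed.
Lemma KimN x : Kim (- x) = - Kim x.
Proof. by case: k x => /= [a|[a b]//]; rewrite oppr0. Qed.
Lemma Kre0 : Kre (0 : K) = 0. Proof. by case: k. Qed.
Lemma Kim0 : Kim (0 : K) = 0. Proof. by case: k. Qed.
Lemma Kre1 : Kre (1 : K) = 1. Proof. by case: k. Qed.
Lemma Kim1 : Kim (1 : K) = 0. Proof. by case: k. Qed.
Lemma Kre_conj x : Kre (Kconj x) = Kre x.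
Proof. by case: k x => //= -[a b]. Qed.
Lemma Kim_conj x : Kim (Kconj x) = - Kim x.
Proof. by case: k x => /= [a|[a b]//]; rewrite oppr0. Qed.
Lemma Kre_real (a : R) : Kre (Kreal k a) = a.
Proof. by case: k. Qed.
Lemma Kim_real (a : R) : Kim (Kreal k a) = 0.
Proof. by case: k. Qed.
Lemma KmkK x : Kmk k (Kre x) (Kim x) = x.
Proof. by case: k x => //= -[a b]. Qed.
Lemma Kre_mk (a b : R) : Kre (Kmk k a b) = a.
Proof. by case: k. Qed.
Lemma Kim_mk (a b : R) : (k = RealBase -> b = 0) -> Kim (Kmk k a b) = b.
Proof. by case: k => //= ->. Qed.
Lemma Kim_realbase x : k = RealBase -> Kim x = 0.
Proof. by move=> kR; move: x; rewrite kR. Qed.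

Lemma eq_Kreim x y : Kre x = Kre y -> Kim x = Kim y -> x = y.
Proof. by move=> rxy ixy; rewrite -(KmkK x) -(KmkK y) rxy ixy. Qed.

Lemma Kabs_sqr x : Kabs x ^+ 2 = Kre x ^+ 2 + Kim x ^+ 2.
Proof.
case: k x => /= [a|[a b]].
  by rewrite -normrX ger0_norm ?sqr_ge0// [0 ^+ 2]expr0n addr0.
by rewrite sqr_sqrtr// addr_ge0// sqr_ge0.
Qed.

Lemma KrealM (a b : R) : Kreal k (a * b) = Kreal k a * Kreal k b.
Proof. by case: k => //=; rewrite rmorphM. Qed.
Lemma KrealV (a : R) : Kreal k (a^-1) = (Kreal k a)^-1.
Proof. by case: k => //=; rewrite fmorphV. Qed.
Lemma Kreal1 : @Kreal R k 1 = 1.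
Proof. by rewrite /Kreal; case: k => //=; rewrite rmorph1. Qed.
Lemma Kreal0 : @Kreal R k 0 = 0.
Proof. by rewrite /Kreal; case: k => //=; rewrite rmorph0. Qed.
Lemma KrealD (a b : R) : Kreal k (a + b) = Kreal k a + Kreal k b.
Proof. by case: k => //=; rewrite rmorphD. Qed.
Lemma Kreal_eq0 (a : R) : (Kreal k a == 0) = (a == 0).
Proof. by case: k => //=; rewrite fmorph_eq0. Qed.
Lemma KrealX (a : R) n : Kreal k (a ^+ n) = Kreal k a ^+ n.
Proof. by case: k => //=; rewrite rmorphXn. Qed.

Lemma KconjM x y : Kconj (x * y) = Kconj x * Kconj y.
Proof. by case: k x y => // x y /=; rewrite rmorphM. Qed.
Lemma KconjD x y : Kconj (x + y) = Kconj x + Kconj y.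
Proof. by case: k x y => // x y /=; rewrite rmorphD. Qed.
Lemma KconjN x : Kconj (- x) = - Kconj x.
Proof. by case: k x => // x /=; rewrite rmorphN. Qed.
Lemma KconjK x : Kconj (Kconj x) = x.
Proof. by apply: eq_Kreim; rewrite ?Kre_conj ?Kim_conj ?opprK. Qed.
Lemma Kconj0 : @Kconj R k 0 = 0.
Proof. by apply: eq_Kreim; rewrite ?Kre_conj ?Kim_conj ?Kim0 ?oppr0. Qed.
Lemma Kconj_real (a : R) : Kconj (Kreal k a) = Kreal k a.
Proof. by apply: eq_Kreim; rewrite ?Kre_conj ?Kim_conj ?Kim_real ?oppr0. Qed.
Lemma KmulJ x : Kconj x * x = Kreal k (Kre x ^+ 2 + Kim x ^+ 2).
Proof.
apply: eq_Kreim; rewrite ?KreM ?KimM Kre_conj Kim_conj ?Kre_real ?Kim_real; ring.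
Qed.

(** The radius [ep] lives in [K]; for K = C, positivity forces its imaginary part to vanish and the
    real part is the actual radius. *)
Let Kmk_dist (a b c e : R) (ep : K) : `|a - c| < Kre ep / 2 -> `|b - e| < Kre ep / 2 ->
  0 < ep -> `|Kmk k a b - Kmk k c e| < ep.
Proof.
move=> ac be ep0; move: ep ac be ep0; case: k => /= [ep ac be ep0|[er ei] /= ac be].
  rewrite (lt_trans ac)// ltr_pdivrMr// mulr_natr mulr2n; lra.
rewrite ltcE/= => /andP[/eqP -> er0]; rewrite ltcE/= eqxx/=.
rewrite -[ltRHS]gtr0_norm// -sqrtr_sqr ltr_sqrt; last by rewrite exprn_gt0.
rewrite -(real_normK (num_real (a - c))) -(real_normK (num_real (b - e))).
have := normr_ge0 (a - c); have := normr_ge0 (b - e); nra.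
Qed.

Lemma Kmk_continuous (T : topologicalType) (f g : T -> R) (t : T) :
  {for t, continuous f} -> {for t, continuous g} ->
  {for t, continuous (fun s => Kmk k (f s) (g s))}.
Proof.
move=> cf cg; apply/cvgrPdist_lt => /= ep ep0.
have ep20 : 0 < Kre ep / 2.
  by apply: divr_gt0 => //; move: ep ep0; case: k => //= -[er ei]; rewrite ltcE => /andP[].
have fn : \forall s \near t, `|f t - f s| < Kre ep / 2 by exact: cvgr_dist_lt.
have gn : \forall s \near t, `|g t - g s| < Kre ep / 2 by exact: cvgr_dist_lt.
by near=> s; apply: Kmk_dist => //; near: s.
Unshelve. all: by end_near. Qed.

Let Kre_dist x y (ep : R) : `|x - y| < Kreal k ep ->
    `|Kre x - Kre y| < ep /\ `|Kim x - Kim y| < ep.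
Proof.
case: k x y => /= [x y xy|[a b] [c e]]; first by rewrite subrr normr0; split=> //;
    exact: le_lt_trans xy.
rewrite ltcE/= => /andP[_ xy].
by split; apply: le_lt_trans xy; rewrite -sqrtr_sqr ler_wsqrtr// ?lerDl ?lerDr sqr_ge0.
Qed.

Lemma Kre_continuous : continuous (@Kre R k).
Proof.
move=> x; apply/(@cvgrPdist_lt _ _ _ (nbhs x)) => /= ep ep0.
have ek0 : 0 < Kreal k ep by move: ep0; case: k => //= ep0; rewrite ltcE/= eqxx.
by apply/nbhs_ballP; exists (Kreal k ep) => // s /Kre_dist[].
Qed.

Lemma Kim_continuous : continuous (@Kim R k).
Proof.
move=> x; apply/(@cvgrPdist_lt _ _ _ (nbhs x)) => /= ep ep0.
have ek0 : 0 < Kreal k ep by move: ep0; case: k => //= ep0; rewrite ltcE/= eqxx.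
by apply/nbhs_ballP; exists (Kreal k ep) => // s /Kre_dist[].
Qed.

End CoordinatesTheory.

Lemma is_derive_mulr (R : realType) (c s : R) :
  is_derive s (1 : R) (fun u : R => u * c) c.
Proof.
apply: (is_derive_eq (is_deriveM (is_derive_id s 1) (is_derive_cst c s 1))).
by rewrite /GRing.scale /= mulr0 add0r mulr1.
Qed.

(** A mean value inequality whose [dl] and [ep] can be chosen once for all points of the sphere;
    this is what permits differentiation under the mean. *)
Lemma linear_approx (R : realType) (G G' : R -> R) (s0 c ep dl : R) :
  (forall s, `|s - s0| < dl -> is_derive s 1 G (G' s) /\ `|G' s - c| <= ep) ->
  forall h, `|h| < dl -> `|G (s0 + h) - G s0 - h * c| <= ep * `|h|.
Proof.
move=> dG h hdl.
have cG (a b : R) : (forall s : R, s \in `[a, b] -> `|s - s0| < dl) -> {within `[a,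
    b], continuous G}.
  move=> ab; apply: derivable_within_continuous => s sab.
  by have [? _] := dG _ (ab _ sab).
have key (a b x : R) : a <= b -> (forall s : R, s \in `[a, b] -> `|s - s0| < dl) ->
    b - a = `|x| -> `|G b - G a - (b - a) * c| <= ep * `|x|.
  move=> ab sab <-.
  have [|t tab ->] := @MVT_segment _ G G' a b ab _ (cG _ _ sab).
    move=> s sI; have [] := dG s _ => //; apply: sab.
    by move: sI; rewrite !in_itv/= => /andP[/ltW -> /ltW ->].
  rewrite (mulrC (b - a)) -mulrBl normrM (ger0_norm (_ : 0 <= b - a)) ?subr_ge0//.
  by apply: ler_wpM2r; rewrite ?subr_ge0//; have [] := dG t (sab _ tab).
have [h0|h0] := leP 0 h.
  have := key s0 (s0 + h) h; rewrite addrAC subrr add0r; apply.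
  - by rewrite lerDl.
  - move=> s; rewrite in_itv/= => /andP[s1 s2].
    by rewrite (le_lt_trans _ hdl)// !ger0_norm ?subr_ge0 // lerBlDl.
  - by rewrite ger0_norm.
have := key (s0 + h) s0 h.
rewrite opprD addrA subrr add0r mulNr opprK.
rewrite (_ : G s0 - _ + _ = - (G (s0 + h) - G s0 - h * c)) ?normrN; last by ring.
apply.
- by rewrite gerDl ltW.
- move=> s; rewrite in_itv/= => /andP[s1 s2].
  rewrite (le_lt_trans _ hdl)// (ltr0_norm h0) ler0_norm ?subr_le0//; lra.
- by rewrite ltr0_norm.
Qed.

Lemma ord2P (i : 'I_2) : i = 0 \/ i = 1.
Proof. by case: i => -[|[|//]] p; [left|right]; exact/val_inj. Qed.

Section Sphere.
Variables (R : realType) (k : base).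
Local Notation K := (Kfield R k).
Local Notation V := 'cV[K]_2.
Local Notation S := (@Ksphere R k).

Definition xv (v : V) (i : nat) : R :=
  match i with
  | 0 => Kre (v 0 0) | 1 => Kim (v 0 0) | 2 => Kre (v 1 0) | 3 => Kim (v 1 0)
  | _ => 0
  end.

Definition vec (a b c e : R) : V :=
  \col_i if i == 0 then Kmk k a b else Kmk k c e.

Lemma xvK v : vec (xv v 0) (xv v 1) (xv v 2) (xv v 3) = v.
Proof.
apply/matrixP => i j; rewrite mxE !KmkK (ord1 j).
by case: (ord2P i) => ->.
Qed.

Lemma xv_continuous i : continuous (fun v : V => xv v i).
Proof.
move=> v; case: i => [|[|[|[|i]]]] /=; last exact: cst_continuous.
- by apply: (@continuous_comp _ _ _ (fun v : V => v 0 0) (@Kre R k));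
    [exact: coord_continuous|exact: Kre_continuous].
- by apply: (@continuous_comp _ _ _ (fun v : V => v 0 0) (@Kim R k));
    [exact: coord_continuous|exact: Kim_continuous].
- by apply: (@continuous_comp _ _ _ (fun v : V => v 1 0) (@Kre R k));
    [exact: coord_continuous|exact: Kre_continuous].
- by apply: (@continuous_comp _ _ _ (fun v : V => v 1 0) (@Kim R k));
    [exact: coord_continuous|exact: Kim_continuous].
Qed.

Definition nsq (v : V) : R :=
  xv v 0 ^+ 2 + xv v 1 ^+ 2 + xv v 2 ^+ 2 + xv v 3 ^+ 2.

Lemma nsq_ge0 v : 0 <= nsq v.
Proof. by rewrite /nsq !addr_ge0// sqr_ge0. Qed.

Lemma enormE v : enorm v = Num.sqrt (nsq v).
Proof. by rewrite /enorm !Kabs_sqr /nsq /= !addrA. Qed.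

Lemma sphereP v : S v <-> nsq v = 1.
Proof.
rewrite /Ksphere /= enormE; split=> [h|->]; last by rewrite sqrtr1.
by rewrite -[LHS]sqr_sqrtr ?nsq_ge0// h expr1n.
Qed.

Lemma nsq_eq0 v : (nsq v == 0) = (v == 0).
Proof.
apply/idP/eqP => [|->]; last first.
  by rewrite /nsq /xv !mxE Kre0 Kim0 !expr0n /= !addr0.
rewrite /nsq !paddr_eq0 ?addr_ge0 ?sqr_ge0// !sqrf_eq0 -!andbA.
move=> /and4P[/eqP h0 /eqP h1 /eqP h2 /eqP h3].
rewrite -(xvK v) h0 h1 h2 h3; apply/matrixP => i j; rewrite !mxE.
by case: ifP => _; apply: eq_Kreim; rewrite ?Kre_mk ?Kim_mk// ?Kre0 ?Kim0.
Qed.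

Lemma nsq_gt0 v : (0 < nsq v) = (v != 0).
Proof. by rewrite lt0r nsq_ge0 nsq_eq0 andbT. Qed.

Lemma sphere_neq0 v : S v -> v != 0.
Proof. by move=> /sphereP v1; rewrite -nsq_gt0 v1. Qed.

Lemma nsq_continuous : continuous nsq.
Proof.
move=> v.
have sq i : {for v, continuous (fun w : V => xv w i ^+ 2)}.
  apply: (@continuous_comp _ _ _ (fun w : V => xv w i) (fun x : R => x ^+ 2)).
    exact: xv_continuous.
  exact: exprn_continuous.
exact: (continuousD (continuousD (continuousD (sq 0%N) (sq 1%N)) (sq 2)) (sq 3)).
Qed.

Lemma closed_sphere : closed S.
Proof.
rewrite (_ : S = nsq @^-1` [set 1]); last by apply/seteqP; split=> v /sphereP.
by apply: preimage_closed => //; move=> v _; exact: nsq_continuous.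
Qed.

(** The sphere is the continuous image of a closed part of the cube [-1, 1]^4; this also covers K =
    R, where [Kmk] discards two of the coordinates. *)
Lemma compact_sphere : compact S.
Proof.
pose f (x : 'rV[R]_4) : V := vec (x 0 0) (x 0 1) (x 0 2%:R) (x 0 3%:R).
have cf : continuous f.
  move=> x; apply: continuous_to_mx => i j.
  rewrite (_ : (fun s => _) = if i == 0 then fun s : 'rV[R]_4 => Kmk k (s 0 0) (s 0 1)
      else fun s => Kmk k (s 0 2%:R) (s 0 3%:R)); last first.
    by apply/funext => s; rewrite /f mxE; case: ifP.
  by case: ifP => _; apply: Kmk_continuous; exact: coord_continuous.
have -> : S = f @` ([set x : 'rV[R]_4 | forall i, x 0 i \in `[-1, 1]] `&` f @^-1` S).
  apply/seteqP; split=> [v Sv|_ [x [_ ? <-]]//].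
  pose x : 'rV[R]_4 := \row_i xv v i.
  have fx : f x = v by rewrite /f /x !mxE -[RHS]xvK.
  exists x => //; split; last by rewrite /preimage /= fx.
  move=> i; rewrite mxE in_itv/= -ler_norml -[leRHS]normr1 -ler_sqr ?nnegrE//.
  rewrite normr1 expr1n real_normK ?num_real//.
  move: Sv => /sphereP <-; rewrite /nsq.
  have h j := sqr_ge0 (xv v j).
  by case: i => -[|[|[|[|]]]]//= _; move: (h 0%N) (h 1%N) (h 2%N) (h 3%N) => /=; lra.
apply: continuous_compact; first exact/continuous_subspaceT.
apply: (subclosed_compact _ (B := [set x : 'rV[R]_4 | forall i, x 0 i \in `[-1, 1]])).
- apply: closedI; last by apply: preimage_closed; [move=> ? _;
    exact: cf|exact: closed_sphere].
  have := @rV_compact R 4 (fun=> `[-1, 1]%classic) (fun=> @segment_compact _ _ _).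
  by apply: compact_closed; exact: norm_hausdorff.
- by have := @rV_compact R 4 (fun=> `[-1, 1]%classic) (fun=> @segment_compact _ _ _).
- exact: subIsetl.
Qed.

Lemma sphere_nonempty : S !=set0.
Proof.
exists (vec 1 0 0 0); apply/sphereP; rewrite /nsq /xv !mxE /= !Kre_mk !Kim_mk//.
by rewrite expr1n !expr0n /= !addr0.
Qed.

End Sphere.

(** * Means over the sphere *)

Section Mean.
Variables (R : realType) (k : base) (sigma : probability (Kborel R k) R).
Local Notation K := (Kfield R k).
Local Notation V := 'cV[K]_2.
Local Notation S := (@Ksphere R k).
Hypothesis sigmaS : sigma S = 1%E.

Definition mean (g : V -> R) : R := (\int[sigma]_(v in S) g v)%R.

(** A sufficient condition for integrability that is closed under sums and products, unlike
    integrability itself. *)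
Definition good (g : V -> R) : Prop :=
  measurable_fun setT (g : Kborel R k -> R) /\
  exists M, forall v, S v -> `|g v| <= M.

Lemma measurable_open (A : set V) : open A -> measurable (A : set (Kborel R k)).
Proof. by move=> oA; exact: sub_sigma_algebra. Qed.

Lemma measurable_sphere : measurable (S : set (Kborel R k)).
Proof.
rewrite -(setCK S); apply: measurableC; apply: measurable_open.
by rewrite openC; exact: closed_sphere.
Qed.

Lemma measurable_continuous (g : V -> R) : continuous g ->
  measurable_fun setT (g : Kborel R k -> R).
Proof.
move=> cg; apply: (measurability _ (measurable_realfun.RGenOpens.measurableE R)).
move=> _ [_ [a [b ->] <-]]; rewrite setTI.
apply: measurable_open; apply: open_comp; last exact: interval_open.
by move=> v _; exact: cg.
Qed.

Lemma good_integrable g : good g -> sigma.-integrable S (EFin \o g).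
Proof.
move=> [mg [M gM]]; apply: measurable_bounded_integrable.
- exact: measurable_sphere.
- by rewrite [X in (X < _)%E](_ : _ = sigma S)// sigmaS ltry.
- exact: measurable_funTS.
- by exists M; split; [exact: num_real|move=> x Mx v /gM /le_trans; apply; exact: ltW].
Qed.

Lemma good_cst c : good (cst c).
Proof. by split=> //; exists `|c|. Qed.

Lemma goodD f g : good f -> good g -> good (fun v => f v + g v).
Proof.
move=> [mf [M fM]] [mg [N gN]]; split; first exact: measurable_realfun.measurable_funD.
by exists (M + N) => v Sv; rewrite (le_trans (ler_normD _ _))// lerD ?fM ?gN.
Qed.

Lemma goodM f g : good f -> good g -> good (fun v => f v * g v).
Proof.
move=> [mf [M fM]] [mg [N gN]]; split; first exact: measurable_realfun.measurable_funM.
by exists (M * N) => v Sv; rewrite normrM ler_pM ?fM ?gN.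
Qed.

Lemma goodZ c g : good g -> good (fun v => c * g v).
Proof. by move=> gg; apply: goodM => //; exact: good_cst. Qed.

Lemma eq_mean f g : (forall v, S v -> f v = g v) -> mean f = mean g.
Proof. by move=> fg; apply: eq_Rintegral => v /set_mem /fg. Qed.

Lemma mean_cst c : mean (cst c) = c.
Proof.
rewrite /mean Rintegral_cst; last exact: measurable_sphere.
by rewrite [X in fine X](_ : _ = sigma S)// sigmaS mulr1.
Qed.

Lemma meanD f g : good f -> good g -> mean (fun v => f v + g v) = mean f + mean g.
Proof.
move=> gf gg; rewrite /mean RintegralD//; [exact: measurable_sphere| |];
  exact: good_integrable.
Qed.

Lemma meanZ c g : good g -> mean (fun v => c * g v) = c * mean g.
Proof.
by move=> gg; rewrite /mean RintegralZl//;
    [exact: measurable_sphere|exact: good_integrable].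
Qed.

Lemma le_mean f g : good f -> good g -> (forall v, S v -> f v <= g v) ->
  mean f <= mean g.
Proof.
move=> gf gg fg; apply: le_Rintegral => //; [exact: measurable_sphere| |];
  exact: good_integrable.
Qed.

Lemma mean_ge0 g : (forall v, S v -> 0 <= g v) -> 0 <= mean g.
Proof. by move=> g0; exact: Rintegral_ge0. Qed.

Lemma goodN f : good f -> good (fun v => - f v).
Proof.
move=> gf; rewrite (_ : (fun v => _) = (fun v => -1 * f v)); first exact: goodZ.
by apply/funext => v; rewrite mulN1r.
Qed.

Lemma goodB f g : good f -> good g -> good (fun v => f v - g v).
Proof. by move=> gf gg; apply: goodD => //; exact: goodN. Qed.

Lemma meanB f g : good f -> good g -> mean (fun v => f v - g v) = mean f - mean g.
Proof.
move=> gf gg; rewrite meanD//; last exact: goodN.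
by rewrite -mulN1r -meanZ//; congr (_ + _); apply: eq_mean => v _; rewrite mulN1r.
Qed.

Lemma mean_dist f g ep : good f -> good g ->
  (forall v, S v -> `|f v - g v| <= ep) -> `|mean f - mean g| <= ep.
Proof.
move=> gf gg fg; rewrite -meanB// ler_norml; apply/andP; split.
  rewrite -(mean_cst (- ep)); apply: le_mean; [exact: good_cst|exact: goodB|].
  by move=> v /fg; rewrite ler_norml => /andP[].
rewrite -[leRHS]mean_cst; apply: le_mean; [exact: goodB|exact: good_cst|].
by move=> v /fg; rewrite ler_norml => /andP[].
Qed.

Lemma measurable_xv i : measurable_fun setT ((fun v : V => xv v i) : Kborel R k -> R).
Proof. by apply: measurable_continuous; exact: xv_continuous. Qed.

(** Continuity is joint in the point and the parameter, so that compactness of the sphere makes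
    estimates near [p] uniform in [v]. *)
Definition admissible (P : topologicalType) (r : P -> V -> nat -> R) (p : P) : Prop :=
  (forall v i, S v -> {for (v, p), continuous (fun q : V * P => r q.2 q.1 i)}) /\
  (forall q i, measurable_fun setT ((fun v => r q v i) : Kborel R k -> R)).

Lemma admissible_slice (P : topologicalType) (r : P -> V -> nat -> R) p v i :
  admissible r p -> S v -> {for v, continuous (fun w => r p w i)}.
Proof.
move=> [cr _] Sv.
apply: (@continuous_comp _ _ _ (fun w => (w, p)) (fun q : V * P => r q.2 q.1 i)).
  move=> A [[B C] [/= nB nC] BC].
  by apply: filterS nB => w Bw; apply: BC; split=> //; exact: nbhs_singleton.
exact: cr.
Qed.

Lemma good_ev (P : topologicalType) (r : P -> V -> nat -> R) p e :
  admissible r p -> (forall v, S v -> wf (r p v) e) -> good (fun v => ev (r p v) e).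
Proof.
move=> ar we; split; first by apply: measurable_ev => i; case: ar.
have : {within S, continuous (fun v => `|ev (r p v) e|)}.
  apply: continuous_in_subspaceT => v /set_mem Sv.
  apply: (@continuous_comp _ _ _ (fun w => ev (r p w) e) (@Num.norm _ R)).
    by apply: ev_continuous; [move=> i; exact: admissible_slice|exact: we].
  exact: norm_continuous.
move=> /(compact_EVT_max (@sphere_nonempty R k) (@compact_sphere R k))[c _ cM].
by exists `|ev (r p c) e| => v Sv; apply: cM; exact: mem_set.
Qed.

Lemma admissible_uniform (P : topologicalType) (r : P -> V -> nat -> R) p e ep :
  admissible r p -> (forall v, S v -> wf (r p v) e) -> 0 < ep ->
  \forall q \near p, forall v, S v ->
    wf (r q v) e /\ `|ev (r q v) e - ev (r p v) e| < ep.
Proof.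
move=> ar we ep0.
have /compact_near_coveringP cS := @compact_sphere R k.
have := cS P (nbhs p) (fun q v => wf (r q v) e /\ `|ev (r q v) e - ev (r p v) e| < ep) _.
apply=> v Sv.
have cr : forall i, {for (v, p), continuous (fun q : V * P => r q.2 q.1 i)}.
  by move=> i; case: ar => + _; apply.
have wfn := wf_near cr (we v Sv).
have cn := ev_continuous cr (we v Sv).
have cn0 : {for (v, p), continuous (fun q : V * P => ev (r p q.1) e)}.
  apply: (@continuous_comp _ _ _ (@fst V P) (fun w => ev (r p w) e)).
    exact: cvg_fst.
  by apply: ev_continuous; [move=> i; exact: admissible_slice|exact: we].
(* The covering criterion moves [v] together with the parameter, so both values are compared with
   the one at the centre [(v, p)]. *)
have n1 : \forall q \near (v, p), `|ev (r q.2 q.1) e - ev (r p v) e| < ep / 2.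
  have /cn : nbhs (ev (r p v) e) (ball (ev (r p v) e) (ep / 2)).
    by apply: nbhsx_ballx; rewrite divr_gt0.
  move=> H; apply: (@filterS _ (nbhs (v, p)) _ _ _ _ H) => q /=.
  by rewrite /ball/= distrC.
have n2 : \forall q \near (v, p), `|ev (r p v) e - ev (r p q.1) e| < ep / 2.
  have /cn0 : nbhs (ev (r p v) e) (ball (ev (r p v) e) (ep / 2)).
    by apply: nbhsx_ballx; rewrite divr_gt0.
  by move=> H; apply: (@filterS _ (nbhs (v, p)) _ _ _ _ H).
have : \forall q \near (v, p), wf (r q.2 q.1) e /\
    `|ev (r q.2 q.1) e - ev (r p q.1) e| < ep.
  near=> q; split; first by near: q.
  rewrite (splitr ep) (le_lt_trans (ler_distD (ev (r p v) e) _ _))//.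
  by rewrite ltrD//; near: q.
by [].
Unshelve. all: by end_near. Qed.

End Mean.

Section MeanParam.
Variables (R : realType) (k : base) (sigma : probability (Kborel R k) R).
Local Notation K := (Kfield R k).
Local Notation V := 'cV[K]_2.
Local Notation S := (@Ksphere R k).
Hypothesis sigmaS : sigma S = 1%E.

Lemma good_near (P : topologicalType) (r : P -> V -> nat -> R) p e :
  admissible r p -> (forall v, S v -> wf (r p v) e) ->
  \forall q \near p, good (fun v => ev (r q v) e).
Proof.
move=> ar we; have [_ [M gM]] := good_ev ar we.
apply: filterS (admissible_uniform ar we ltr01) => q rq.
split; first by apply: measurable_ev => i; case: ar.
exists (1 + M) => v Sv; have [_ h] := rq v Sv.
rewrite -(subrK (ev (r p v) e) (ev (r q v) e)) (le_trans (ler_normD _ _))// lerD ?gM//.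
exact: ltW.
Qed.

Lemma mean_continuous (P : topologicalType) (r : P -> V -> nat -> R) p e :
  admissible r p -> (forall v, S v -> wf (r p v) e) ->
  {for p, continuous (fun q => mean sigma (fun v => ev (r q v) e))}.
Proof.
move=> ar we; apply/(@cvgrPdist_le _ _ _ (nbhs p)) => ep ep0.
have gp := good_ev ar we.
apply: filterS2 (good_near ar we) (admissible_uniform ar we ep0) => q gq rq.
apply: (mean_dist sigmaS) => // v Sv; rewrite distrC ltW//.
by have [] := rq v Sv.
Qed.

(** Near [s0] the derivative of the integrand is within [ep] of its value at [s0], uniformly on the
    sphere. By [linear_approx] the difference quotients are equally close to it, and so are their
    means. *)
Lemma mean_derive (r : R -> V -> nat -> R) (s0 : R) (d : nat -> expr R) (e : expr R) :
  admissible r s0 ->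
  (\forall s \near s0, forall v i, S v ->
    is_derive (s : R) (1 : R) (fun u : R => r u v i) (ev (r s v) (d i))) ->
  (forall v, S v -> wf (r s0 v) e) ->
  (forall v i, S v -> wf (r s0 v) (d i)) ->
  is_derive s0 (1 : R) (fun s : R => mean sigma (fun v => ev (r s v) e))
    (mean sigma (fun v => ev (r s0 v) (dv d e))).
Proof.
move=> ar dr we wd.
have wde v : S v -> wf (r s0 v) (dv d e) by move=> Sv; apply: wf_dv; [move=> i;
    exact: wd|exact: we].
have g0 := good_ev ar we; have gd := good_ev ar wde.
set M := fun s => _; set D := mean _ _.
have cvgD : h^-1 *: (M (h *: 1 + s0) - M s0) @[h --> 0^'] --> D.
  apply/cvgrPdist_le => ep ep0.
  have : \forall s \near s0, good (fun v => ev (r s v) e) /\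
      forall v, S v -> is_derive (s : R) (1 : R) (fun u : R =>
          ev (r u v) e) (ev (r s v) (dv d e)) /\
        `|ev (r s v) (dv d e) - ev (r s0 v) (dv d e)| <= ep.
    near=> s; split; first by near: s; exact: (good_near ar we).
    move=> v Sv; split.
      apply: is_derive_ev; first by move=> i; move: v i Sv; near: s.
      suff [] : wf (r s v) e /\ `|ev (r s v) e - ev (r s0 v) e| < 1 by [].
      by move: v Sv; near: s; exact: (admissible_uniform ar we ltr01).
    apply: ltW; suff [] : wf (r s v) (dv d e) /\ `|ev (r s v) (dv d e) - ev (r s0
        v) (dv d e)| < ep by [].
    by move: v Sv; near: s; exact: (admissible_uniform ar wde ep0).
  move=> /nbhs_ballP[dl /= dl0 Hdl].
  have n1 : \forall h \near (0 : R)^', `|h| < dl by exact: dnbhs0_lt.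
  have n2 : \forall h \near (0 : R)^', h != 0 by exact: nbhs_dnbhs_neq.
  apply: filterS2 n1 n2 => h hdl h0.
  have [gh _] : good (fun v => ev (r (s0 + h) v) e) /\ True.
    by split=> //; have [] := Hdl (s0 + h);
        rewrite ?/ball/= ?opprD ?addrA ?subrr ?sub0r ?normrN.
  rewrite distrC /GRing.scale /= mulr1 (addrC h).
  have -> : h^-1 * (M (s0 + h) - M s0) - D = h^-1 * (M (s0 + h) - M s0 - h * D).
    by rewrite [RHS]mulrBr mulKf.
  rewrite normrM normfV ler_pdivrMl ?normr_gt0// [leRHS]mulrC.
  rewrite [X in `|X|](_ : _ =
      mean sigma (fun v => ev (r (s0 + h) v) e - ev (r s0 v) e) -
      mean sigma (fun v => h * ev (r s0 v) (dv d e))); last first.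
    by rewrite (meanB sigmaS)// (meanZ sigmaS).
  apply: (mean_dist sigmaS); [exact: goodB|exact: goodZ|] => v Sv.
  apply: (@linear_approx _ (fun s => ev (r s v) e) (fun s =>
      ev (r s v) (dv d e)) s0 _ ep dl) => // s sdl.
  have [] := Hdl s; first by rewrite /ball/= distrC.
  by move=> _; apply.
by apply: DeriveDef; [apply/cvg_ex; exists D|exact: cvg_lim].
Unshelve. all: by end_near. Qed.

End MeanParam.

(** * Invariance of the mean *)

Section Invariance.
Variables (R : realType) (k : base) (sigma : probability (Kborel R k) R).
Local Notation K := (Kfield R k).
Local Notation V := 'cV[K]_2.
Local Notation S := (@Ksphere R k).
Hypothesis sigma_inv : rotation_invariant sigma.

Let sigmaS : sigma S = 1%E. Proof. by case: sigma_inv. Qed.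

Lemma conj_mulmx m n p (u : 'M[K]_(m, n)) (w : 'M[K]_(n, p)) :
  map_mx (@Kconj R k) (u *m w) = map_mx (@Kconj R k) u *m map_mx (@Kconj R k) w.
Proof.
apply/matrixP => i j; rewrite !mxE (big_morph (@Kconj R k) (@KconjD R k) (Kconj0 R k)).
by apply: eq_bigr => l _; rewrite !mxE KconjM.
Qed.

Lemma nsq_dot (v : V) :
  ((map_mx (@Kconj R k) v)^T *m v) 0 0 = Kreal k (nsq v).
Proof.
rewrite mxE !big_ord_recl big_ord0 addr0 !mxE.
rewrite (_ : lift ord0 ord0 = 1); last exact/val_inj.
by rewrite !KmulJ -KrealD /nsq /xv !addrA.
Qed.

Lemma nsq_SU2 (u : 'M[K]_2) (v : V) : SU2 u -> nsq (u *m v) = nsq v.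
Proof.
move=> [_ uu]; have /(congr1 (@Kre R k)) : Kreal k (nsq (u *m v)) = Kreal k (nsq v).
  rewrite -!nsq_dot; congr (fun_of_matrix _ 0 0).
  by rewrite conj_mulmx trmx_mul mulmxA -(mulmxA _ _ u) uu mulmx1.
by rewrite !Kre_real.
Qed.

Lemma measurable_mulmx (u : 'M[K]_2) :
  measurable_fun setT ((fun v : V => u *m v) : Kborel R k -> Kborel R k).
Proof.
have cu : continuous (fun v : V => u *m v).
  move=> v; apply: continuous_to_mx => i j; rewrite (ord1 j).
  rewrite (_ : (fun s => _) = (fun s : V => u i 0 * s 0 0 + u i 1 * s 1 0)); last first.
    by apply/funext => s; rewrite mulmx2E.
  have c0 (i' : 'I_2) : {for v, continuous (fun s : V =>
      s i' 0)} by exact: coord_continuous.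
  have cc (c : K) : {for v, continuous (fun s : V => c)} by exact: cst_continuous.
  exact: (continuousD (continuousM (cc (u i 0)) (c0 0)) (continuousM (cc (u i 1)) (c0 1))).
apply: measurability => //.
move=> _ [W oW <-]; rewrite setTI; apply: measurable_open.
by apply: open_comp => // v _; exact: cu.
Qed.

Lemma good_mulmx (u : 'M[K]_2) g : SU2 u -> good g -> good (fun v => g (u *m v)).
Proof.
move=> su [mg [M gM]]; split.
  exact: (measurableT_comp (f := g : Kborel R k -> R) mg (measurable_mulmx u)).
by exists M => v /sphereP Sv; apply: gM; apply/sphereP; rewrite nsq_SU2.
Qed.

(** The pushforward of [sigma] under [u] agrees with [sigma] on Borel sets, and [u] preserves the
    sphere. *)
Lemma mean_SU2 (u : 'M[K]_2) g : SU2 u -> good g ->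
  mean sigma (fun v => g (u *m v)) = mean sigma g.
Proof.
move=> su gg; pose phi : Kborel R k -> Kborel R k := fun v => u *m v.
have mphi : measurable_fun setT phi by exact: measurable_mulmx.
have preS : phi @^-1` S = S by apply/seteqP; split => v /sphereP h; apply/sphereP;
    move: h; rewrite nsq_SU2.
have mS : measurable (S : set (Kborel R k)) by exact: measurable_sphere.
rewrite /mean /Rintegral; congr fine.
transitivity (\int[sigma]_(v in phi @^-1` S) ((EFin \o g) \o phi) v)%E;
    first by rewrite preS.
rewrite -(@integral_pushforward _ _ _ _ R phi mphi sigma S (EFin \o g)) //.
- apply: eq_measure_integral => A mA _.
  by case: sigma_inv => _; exact.
- by apply/measurable_realfun.measurable_EFinP; case: gg.
- by rewrite preS; exact: (good_integrable sigmaS (good_mulmx su gg)).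
Qed.

End Invariance.

(** * Linear vector fields and their flows *)

Section LinearFields.
Variable R : realType.
Implicit Types (m b : nat -> nat -> R) (f g : nat -> R).

Definition dot4 f g : R := f 0%N * g 0%N + f 1%N * g 1%N + f 2 * g 2 + f 3 * g 3.

Definition linfield b (i : nat) : expr R :=
  Add (Add (Add (Mul (Cst (b i 0%N)) (Var R 0)) (Mul (Cst (b i 1%N)) (Var R 1)))
    (Mul (Cst (b i 2)) (Var R 2))) (Mul (Cst (b i 3)) (Var R 3)).

Lemma ev_linfield r b i : ev r (linfield b i) = dot4 (b i) r. Proof. by []. Qed.

Lemma wf_linfield r b i : wf r (linfield b i). Proof. by []. Qed.

(** At a fixed point a derivation depends linearly on the values of its field there; the
    coefficients may thus vary from point to point. *)
Lemma dv_comb4 r (d d1 d2 d3 d4 : nat -> expr R) (a1 a2 a3 a4 : R) e :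
  (forall i, ev r (d i) = a1 * ev r (d1 i) + a2 * ev r (d2 i) +
    a3 * ev r (d3 i) + a4 * ev r (d4 i)) ->
  ev r (dv d e) = a1 * ev r (dv d1 e) + a2 * ev r (dv d2 e) +
    a3 * ev r (dv d3 e) + a4 * ev r (dv d4 e).
Proof.
move=> dE; elim: e => //= [c|e1 -> e2 ->|e1 -> e2 ->|e1 ->|e1 ->]; ring.
Qed.

(** The chain rule: the hypothesis says that the substitution [f] maps the field [d] to the field
    [d']. *)
Lemma dv_sub r (d d' f : nat -> expr R) e :
  (forall i, ev r (dv d (f i)) = ev (fun j => ev r (f j)) (d' i)) ->
  ev r (dv d (sub f e)) = ev (fun j => ev r (f j)) (dv d' e).
Proof. by move=> dE; elim: e => //= [a -> b ->|a -> b ->|a ->|a ->]; rewrite ?ev_sub. Qed.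

End LinearFields.

Section LinearFlows.
Variables (R : realType) (k : base) (sigma : probability (Kborel R k) R).
Local Notation K := (Kfield R k).
Local Notation V := 'cV[K]_2.
Local Notation S := (@Ksphere R k).
Hypothesis sigma_inv : rotation_invariant sigma.
Let sigmaS : sigma S = 1%E. Proof. by case: sigma_inv. Qed.

Lemma admissible_lin (m : R -> nat -> nat -> R) (phi : R -> V -> V) (s0 : R) :
  (forall s v i, xv (phi s v) i = dot4 (m s i) (xv v)) ->
  (forall i j, {for s0, continuous (fun s => m s i j)}) ->
  admissible (fun s v => xv (phi s v)) s0.
Proof.
move=> mE cm; split.
  move=> v i _.
  rewrite (_ : (fun q : V * R => _) = (fun q : V * R => dot4 (m q.2 i) (xv q.1)));
      last first.
    by apply/funext => q; rewrite mE.
  have c1 j : {for (v, s0), continuous (fun q : V * R => m q.2 i j)}.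
    apply: (@continuous_comp _ _ _ (@snd V R) (fun s => m s i j)); first exact: cvg_snd.
    exact: cm.
  have c2 j : {for (v, s0), continuous (fun q : V * R => xv q.1 j)}.
    apply: (@continuous_comp _ _ _ (@fst V R) (fun w => xv w j)); first exact: cvg_fst.
    exact: xv_continuous.
  exact: (continuousD (continuousD (continuousD (continuousM (c1 0%N) (c2 0%N))
    (continuousM (c1 1%N) (c2 1%N))) (continuousM (c1 2) (c2 2))) (continuousM (c1
        3) (c2 3))).
move=> s i.
rewrite (_ : (fun v : V => _) = (fun v : V => ev (xv v) (linfield (m s) i))); last first.
  by apply/funext => v; rewrite mE.
by apply: measurable_ev => j; exact: measurable_xv.
Qed.

(** Since m' = b m, the path s -> phi s v is an integral curve of the linear field [b], along which
    expressions are derived by [dv (linfield b)]. *)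
Lemma mean_flow (m : R -> nat -> nat -> R) (b : nat -> nat -> R) (phi : R -> V -> V)
    (s0 : R) (e : expr R) :
  (forall s v i, xv (phi s v) i = dot4 (m s i) (xv v)) ->
  (forall (s : R) i j, is_derive s (1 : R) (fun u : R => m u i j)
     (dot4 (b i) (fun l => m s l j))) ->
  (forall v, S v -> wf (xv (phi s0 v)) e) ->
  is_derive s0 (1 : R) (fun s : R => mean sigma (fun v => ev (xv (phi s v)) e))
    (mean sigma (fun v => ev (xv (phi s0 v)) (dv (linfield b) e))).
Proof.
move=> mE dm we.
apply: (@mean_derive R k sigma sigmaS (fun s v => xv (phi s v))) => //.
  apply: (admissible_lin mE) => i j; apply: differentiable_continuous.
  by apply/derivable1_diffP; have [] := dm s0 i j.
apply: (@filterE _ (nbhs s0)) => s v i _.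
rewrite (_ : (fun u : R => _) = (fun u : R => dot4 (m u i) (xv v))); last first.
  by apply/funext => u; rewrite mE.
have dc j : is_derive s (1 : R) (fun u : R => m u i j * xv v j)
    (dot4 (b i) (fun l => m s l j) * xv v j).
  apply: (is_derive_eq (is_deriveM (dm s i j) (is_derive_cst (xv v j) s 1))).
  by rewrite /GRing.scale /= mulr0 add0r mulrC.
apply: (is_derive_eq (is_deriveD (is_deriveD (is_deriveD (dc 0%N) (dc 1%N)) (dc 2))
    (dc 3))).
rewrite ev_linfield /dot4 !mE /dot4; ring.
Qed.

End LinearFlows.

Section RealMatrices.
Variable R : realType.

(* Left multiplication by ((a, -b^* ), (b, a^* )), a = ar + i ai, b = br + i bi,
   in the coordinates xv. *)
Definition msu (ar ai br bi : R) (i j : nat) : R :=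
  match i, j with
  | 0, 0 => ar | 0, 1 => - ai | 0, 2 => - br | 0, 3 => - bi
  | 1, 0 => ai | 1, 1 => ar | 1, 2 => bi | 1, 3 => - br
  | 2, 0 => br | 2, 1 => - bi | 2, 2 => ar | 2, 3 => ai
  | 3, 0 => bi | 3, 1 => br | 3, 2 => - ai | 3, 3 => ar
  | _, _ => 0
  end.

(* Left multiplication by ((a, z), (0, b)), z = zr + i zi. *)
Definition mtri (a b zr zi : R) (i j : nat) : R :=
  match i, j with
  | 0, 0 => a | 0, 2 => zr | 0, 3 => - zi
  | 1, 1 => a | 1, 2 => zi | 1, 3 => zr
  | 2, 2 => b
  | 3, 3 => b
  | _, _ => 0
  end.

Definition dotE (f g : nat -> expr R) : expr R :=
  Add (Add (Add (Mul (f 0%N) (g 0%N)) (Mul (f 1%N) (g 1%N))) (Mul (f 2) (g 2)))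
    (Mul (f 3) (g 3)).

Lemma dot4_default (f g : nat -> R) : (forall j, f j = 0) -> dot4 f g = 0.
Proof. by move=> f0; rewrite /dot4 !f0 !mul0r !addr0. Qed.

(** The radial field x -> x, as [msu 1 0 0 0] is the identity on the indices 0 to 3. *)
Definition euler := linfield (msu 1 0 0 0).

End RealMatrices.

(** * Integration by parts along infinitesimal rotations *)

Section ByParts.
Variables (R : realType) (k : base) (sigma : probability (Kborel R k) R).
Local Notation K := (Kfield R k).
Local Notation V := 'cV[K]_2.
Local Notation S := (@Ksphere R k).
Hypothesis sigma_inv : rotation_invariant sigma.
Let sigmaS : sigma S = 1%E. Proof. by case: sigma_inv. Qed.

Definition su (a b : K) : 'M[K]_2 :=
  \matrix_(i, j) if i == 0 then (if j == 0 then a else - Kconj b)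
    else (if j == 0 then b else Kconj a).

Definition trimx (a b : R) (z : K) : 'M[K]_2 :=
  \matrix_(i, j) if i == 0 then (if j == 0 then Kreal k a else z)
    else (if j == 0 then 0 else Kreal k b).

Lemma xv_su (a b : K) (v : V) i :
  xv (su a b *m v) i = dot4 (msu (Kre a) (Kim a) (Kre b) (Kim b) i) (xv v).
Proof.
case: i => [|[|[|[|i]]]]; last by rewrite dot4_default//= => -[|[|[|[|]]]].
all: rewrite /xv /dot4 /= mulmx2E !mxE /=.
all: rewrite ?(KreD, KimD, KreM, KimM, KreN, KimN, Kre_conj, Kim_conj); ring.
Qed.

Lemma xv_trimx (a b : R) (z : K) (v : V) i :
  xv (trimx a b z *m v) i = dot4 (mtri a b (Kre z) (Kim z) i) (xv v).
Proof.
case: i => [|[|[|[|i]]]]; last by rewrite dot4_default//= => -[|[|[|[|]]]].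
all: rewrite /xv /dot4 /= mulmx2E !mxE /=.
all: rewrite ?(KreD, KimD, KreM, KimM, Kre_real, Kim_real, Kre0, Kim0); ring.
Qed.

Lemma matrix2P (g h : 'M[K]_2) : g 0 0 = h 0 0 -> g 0 1 = h 0 1 -> g 1 0 = h 1 0 ->
  g 1 1 = h 1 1 -> g = h.
Proof.
by move=> *; apply/matrixP => i j; case: (ord2P i) => ->; case: (ord2P j) => ->.
Qed.

Lemma det_mx2 (g : 'M[K]_2) : \det g = g 0 0 * g 1 1 - g 0 1 * g 1 0.
Proof.
have l1 : lift ord0 ord0 = 1 :> 'I_2 by exact/val_inj.
have l0 : lift (1 : 'I_2) (0 : 'I_1) = 0 :> 'I_2 by exact/val_inj.
rewrite (expand_det_row _ 0) !big_ord_recl big_ord0 addr0 /cofactor !det_mx11 !mxE !l1 !l0.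
by rewrite /= expr0 expr1 mul1r mulN1r mulrN.
Qed.

Lemma su_SU2 (a b : K) :
  Kre a ^+ 2 + Kim a ^+ 2 + (Kre b ^+ 2 + Kim b ^+ 2) = 1 -> SU2 (su a b).
Proof.
move=> ab1.
have ab : Kconj a * a + Kconj b * b = 1 by rewrite !KmulJ -KrealD ab1 Kreal1.
split; first by rewrite det_mx2 !mxE /= -ab; ring.
apply: matrix2P; rewrite mulmx2E !mxE /= ?KconjN ?KconjK -?ab; ring.
Qed.

Lemma admissible_xv : admissible (fun (_ : R) (v : V) => xv v) (0 : R).
Proof.
apply: (@admissible_lin R k (fun=> msu 1 0 0 0) (fun=> id)) => [s v i|i j];
    last exact: cst_continuous.
case: i => [|[|[|[|i]]]]; last by rewrite dot4_default// => -[|[|[|[|]]]].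
all: rewrite /dot4 /=; ring.
Qed.

Lemma good_xv e : (forall v : V, S v -> wf (xv v) e) -> good (fun v : V => ev (xv v) e).
Proof. exact: (good_ev admissible_xv). Qed.

(** J = [msu 0 p q r] satisfies J^2 = -1, so cos s + J sin s is a one-parameter group in SU_2; the
    mean is constant along it and the claim is its derivative at 0. For K = R only p = r = 0
    preserves the slice. *)
Lemma mean_rot (p q r : R) e : p ^+ 2 + q ^+ 2 + r ^+ 2 = 1 ->
  (k = RealBase -> p = 0 /\ r = 0) ->
  (forall v : V, S v -> wf (xv v) e) ->
  mean sigma (fun v => ev (xv v) (dv (linfield (msu 0 p q r)) e)) = 0.
Proof.
move=> pqr kR we.
pose phi (s : R) (v : V) :=
  su (Kmk k (cos s) (sin s * p)) (Kmk k (sin s * q) (sin s * r)) *m v.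
have ph s : SU2 (su (Kmk k (cos s) (sin s * p)) (Kmk k (sin s * q) (sin s * r))).
  apply: su_SU2; rewrite !Kre_mk !Kim_mk => [|/kR[_ ->]|/kR[-> _]]; rewrite ?mulr0//.
  rewrite -(cos2Dsin2 s) -[in RHS](mulr1 (sin s ^+ 2)) -pqr; ring.
have phE s v i : xv (phi s v) i =
    dot4 (msu (cos s) (sin s * p) (sin s * q) (sin s * r) i) (xv v).
  rewrite xv_su !Kre_mk !Kim_mk// => [/kR[_ ->]|/kR[-> _]]; rewrite ?mulr0//.
have we0 v : S v -> wf (xv (phi 0 v)) e.
  by move=> /sphereP Sv; apply: we; apply/sphereP; rewrite (nsq_SU2 _ (ph 0)).
have := mean_flow sigma_inv (b := msu 0 p q r) phE _ we0.
have sinE s : sin s = sin s * (p ^+ 2 + q ^+ 2 + r ^+ 2) by rewrite pqr mulr1.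
have ds (s c : R) : is_derive s (1 : R) (fun u : R => sin u * c) (cos s * c).
  apply: (is_derive_eq (is_deriveM (is_derive_sin s) (is_derive_cst c s 1))).
  by rewrite /GRing.scale /= mulr0 add0r mulrC.
have dNs (s c : R) : is_derive s (1 : R) (fun u : R => - (sin u * c)) (- (cos s * c)).
  exact: is_deriveN.
(* The derivative of cos carries the factor p^2 + q^2 + r^2 = 1 in the form in which it comes out of
   J^2, so that [ring] can match the entries. *)
have dc (s : R) : is_derive s (1 : R) (fun u : R =>
    cos u) (- (sin s * (p ^+ 2 + q ^+ 2 + r ^+ 2))).
  by rewrite pqr mulr1; exact: is_derive_cos.
have d0 (s : R) : is_derive s (1 : R) (fun u : R => 0 : R) 0 by exact: is_derive_cst.
have H (s : R) i j : is_derive s (1 : R)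
    (fun u : R => msu (cos u) (sin u * p) (sin u * q) (sin u * r) i j)
    (dot4 (msu 0 p q r i) (fun l => msu (cos s) (sin s * p) (sin s * q) (sin s * r) l j)).
  case: i => [|[|[|[|i]]]]; case: j => [|[|[|[|j]]]] /=;
    first [apply: (is_derive_eq (dc s)) | apply: (is_derive_eq (ds s _)) |
           apply: (is_derive_eq (dNs s _)) | apply: (is_derive_eq (d0 s)) ];
    rewrite /dot4 /=; ring.
move=> /(_ H) [_ dE].
have phi0 v : phi 0 v = v.
  rewrite /phi sin0 cos0 !mul0r (_ : su _ _ = 1%:M) ?mul1mx//.
  apply: matrix2P; rewrite !mxE /=; apply: eq_Kreim;
    rewrite ?(Kre_conj, Kim_conj, KreN, KimN, Kre_mk, Kim_mk, Kre0, Kim0, Kre1,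
        Kim1) ?oppr0//.
rewrite -[LHS](_ : mean sigma (fun v =>
    ev (xv (phi 0 v)) (dv (linfield (msu 0 p q r)) e)) = _); last first.
  by apply: eq_mean => v _; rewrite phi0.
rewrite -dE (_ : (fun s : R => _) = cst (mean sigma (fun v => ev (xv v) e))).
  by rewrite derive_cst.
apply/funext => s; rewrite -[RHS](mean_SU2 sigma_inv (ph s))//.
exact: good_xv.
Qed.

End ByParts.

Section ChangeOfVariables.
Variables (R : realType) (k : base) (sigma : probability (Kborel R k) R).
Local Notation K := (Kfield R k).
Local Notation V := 'cV[K]_2.
Local Notation S := (@Ksphere R k).
Hypothesis sigma_inv : rotation_invariant sigma.
Let sigmaS : sigma S = 1%E. Proof. by case: sigma_inv. Qed.

(* On the sphere B x is the sum of its component along x and its components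
   along the orthonormal tangent fields T x, T skew; the former acts on e by
   Euler's identity and the latter integrate to zero. *)
Lemma mean_traceless (a zr zi : R) (e : expr R) :
  (k = RealBase -> zi = 0) ->
  (forall v : V, S v -> wf (xv v) e) ->
  (forall v : V, S v -> ev (xv v) (dv (@euler R) e) =
     - (2 * (Kdeg k)%:R) * ev (xv v) e) ->
  mean sigma (fun v => ev (xv v) (dv (linfield (mtri a (- a) zr zi)) e)) = 0.
Proof.
move=> kR we ee.
pose B := linfield (mtri a (- a) zr zi).
pose T p q r := linfield (@msu R 0 p q r).
pose c p q r := dotE B (T p q r).
(* The factor [chi] is 0 for K = R and 1 for K = C: it switches off the two tangent fields that
   leave R^2. *)
pose chi : R := (Kdeg k)%:R - 1.
have chiE : chi = 0 /\ k = RealBase \/ chi = 1 /\ k = ComplexBase.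
  rewrite /chi; case: (k); [left|right]; split=> //; [exact: subrr|].
  by rewrite /= mulr2n addrK.
have kdE : (Kdeg k)%:R = 1 + chi by rewrite /chi addrC subrK.
rewrite kdE in ee.
have wc p q r v : S v -> wf (xv v) (dv (T p q r) (Mul (c p q r) e)).
  move=> Sv; apply: wf_dv => //; split; last exact: we.
  by rewrite /c /dotE /=.
have point v : S v -> ev (xv v) (dv B e) =
    ev (xv v) (dv (T 0 1 0) (Mul (c 0 1 0) e)) +
    (chi * ev (xv v) (dv (T 1 0 0) (Mul (c 1 0 0) e)) +
     chi * ev (xv v) (dv (T 0 0 1) (Mul (c 0 0 1) e))).
  move=> Sv; have /sphereP x1 := Sv.
  pose bv := ev (xv v) (dotE B (@euler R)).
  have dB : ev (xv v) (dv B e) = bv * ev (xv v) (dv (@euler R) e) +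
      ev (xv v) (c 0 1 0) * ev (xv v) (dv (T 0 1 0) e) +
      (chi * ev (xv v) (c 1 0 0)) * ev (xv v) (dv (T 1 0 0) e) +
      (chi * ev (xv v) (c 0 0 1)) * ev (xv v) (dv (T 0 0 1) e).
    apply: dv_comb4 => i.
    rewrite /bv /c /B /T /euler.
    have kR1 : chi = 0 /\ [/\ zi = 0, xv v 1 = 0 & xv v 3 = 0] \/ chi = 1.
      by case: chiE => [[-> kk]|[-> _]]; [left; rewrite kR// /xv !Kim_realbase|right].
    rewrite -(mul1r (ev _ (linfield _ i))) -[in LHS]x1 /nsq.
    move: (xv v) kR1 => x kR1.
    by case: i => [|[|[|[|i]]]] /=; case: kR1 => [[-> [-> -> ->]]|->]; ring.
  (* Deriving <B x, T x> along T gives <B T x, T x> - <B x, x> because T^2 = -1. Summing over the 1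
     + 2 chi tangent fields and using that B is traceless leaves -2 (1 + chi) <B x, x>, which is
     exactly what the degree -2[K : R] contributes in the radial direction. *)
  have tr : 2 * (1 + chi) * bv + ev (xv v) (dv (T 0 1 0) (c 0 1 0)) +
      chi * ev (xv v) (dv (T 1 0 0) (c 1 0 0)) + chi * ev (xv v) (dv (T 0 0 1) (c 0
          0 1)) = 0.
    rewrite /bv /c /B /T /euler.
    have kR1 : chi = 0 /\ [/\ zi = 0, xv v 1 = 0 & xv v 3 = 0] \/ chi = 1.
      by case: chiE => [[-> kk]|[-> _]]; [left; rewrite kR// /xv !Kim_realbase|right].
    move: (xv v) kR1 => x kR1.
    by rewrite /=; case: kR1 => [[-> [-> -> ->]]|->]; ring.
  have mE p q r : ev (xv v) (dv (T p q r) (Mul (c p q r) e)) =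
    ev (xv v) (dv (T p q r) (c p q r)) * ev (xv v) e +
    ev (xv v) (c p q r) * ev (xv v) (dv (T p q r) e) by [].
  rewrite dB ee// !mE.
  move: tr; move: (ev _ (dv (T 0 1 0) (c _ _ _))) (ev _ (dv (T 1 0 0) (c _ _ _)))
    (ev _ (dv (T 0 0 1) (c _ _ _))) => t2 t1 t3 tr.
  apply/eqP; rewrite -subr_eq0; apply/eqP.
  transitivity (- (2 * (1 + chi) * bv + t2 + chi * t1 + chi * t3) * ev (xv v) e).
    by rewrite [c]lock; ring.
  by rewrite tr oppr0 mul0r.
have gT p q r : good (fun v : V => ev (xv v) (dv (T p q r) (Mul (c p q r) e))).
  by apply: good_xv => v; exact: wc.
have weM p q r v : S v -> wf (xv v) (Mul (c p q r) e).
  by move=> Sv; split; [rewrite /c /dotE /=|exact: we].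
rewrite (eq_mean sigma point).
rewrite (meanD sigmaS (gT 0 1 0) (goodD (goodZ chi (gT 1 0 0)) (goodZ chi (gT 0 0 1)))).
rewrite (meanD sigmaS (goodZ chi (gT 1 0 0)) (goodZ chi (gT 0 0 1))).
rewrite (meanZ sigmaS chi (gT 1 0 0)) (meanZ sigmaS chi (gT 0 0 1)).
have mT p q r : p ^+ 2 + q ^+ 2 + r ^+ 2 = 1 -> (k = RealBase -> p = 0 /\ r = 0) ->
    mean sigma (fun v => ev (xv v) (dv (T p q r) (Mul (c p q r) e))) = 0.
  by move=> pqr kpr; apply: (mean_rot sigma_inv) => // v; exact: weM.
rewrite (mT 0 1 0) => [||//]; last by ring.
case: chiE => [[-> _]|[_ kC]]; first by rewrite !mul0r !addr0.
rewrite (mT 1 0 0) => [||]; [|by ring|by rewrite kC].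
rewrite (mT 0 0 1) => [||]; [|by ring|by rewrite kC].
by rewrite mulr0 !addr0.
Qed.

End ChangeOfVariables.

(** * Invariance under upper triangular matrices *)

Section TriangularInvariance.
Variables (R : realType) (k : base) (sigma : probability (Kborel R k) R).
Local Notation K := (Kfield R k).
Local Notation V := 'cV[K]_2.
Local Notation S := (@Ksphere R k).
Hypothesis sigma_inv : rotation_invariant sigma.
Let sigmaS : sigma S = 1%E. Proof. by case: sigma_inv. Qed.

(* Smooth functions on K^2 \ {0} that are homogeneous of degree -2[K : R], in
   the form of Euler's identity; their integrals over the sphere are invariant
   under SL_2(K). *)
Definition density (e : expr R) : Prop :=
  (forall v : V, v != 0 -> wf (xv v) e) /\
  (forall v : V, v != 0 ->
     ev (xv v) (dv (@euler R) e) = - (2 * (Kdeg k)%:R) * ev (xv v) e).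

Lemma unitmx_mul_neq0 (g : 'M[K]_2) (v : V) : g \in unitmx -> v != 0 -> g *m v != 0.
Proof.
by move=> gu; apply: contraNN => /eqP gv; rewrite -(mulKmx gu v) gv mulmx0.
Qed.

Lemma trimx_unit (a b : R) (z : K) : a != 0 -> b != 0 -> trimx a b z \in unitmx.
Proof.
move=> a0 b0; rewrite unitmxE det_mx2 !mxE /= mulr0 subr0 unitfE -KrealM.
by rewrite Kreal_eq0 mulf_neq0.
Qed.

Definition tri_sub (a b : R) (z : K) (e : expr R) : expr R :=
  sub (linfield (mtri a b (Kre z) (Kim z))) e.

Lemma ev_tri_sub a b z e (v : V) :
  ev (xv v) (tri_sub a b z e) = ev (xv (trimx a b z *m v)) e.
Proof. by rewrite ev_sub; apply: eq_ev => i; rewrite xv_trimx. Qed.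

Lemma dv_tri_sub (d d' : nat -> expr R) a b z e (v : V) :
  (forall i, ev (xv v) (dv d (linfield (mtri a b (Kre z) (Kim z)) i)) =
     ev (xv (trimx a b z *m v)) (d' i)) ->
  ev (xv v) (dv d (tri_sub a b z e)) = ev (xv (trimx a b z *m v)) (dv d' e).
Proof.
move=> dE.
have E : (fun j => ev (xv v) (linfield (mtri a b (Kre z) (Kim z)) j)) =1 xv (trimx
    a b z *m v).
  by move=> i; rewrite xv_trimx.
by rewrite (@dv_sub _ _ _ d') => [|i]; [exact: eq_ev|rewrite (eq_ev _ E)].
Qed.

(** Linear maps commute with the radial field, so Euler's identity survives the pullback. *)
Lemma density_tri_sub a b z e : a != 0 -> b != 0 -> density e ->
  density (tri_sub a b z e).
Proof.
move=> a0 b0 [we ee].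
have gv v := unitmx_mul_neq0 (v := v) (trimx_unit z a0 b0).
split=> v v0.
  apply: wf_sub => [i|]; first exact: wf_linfield.
  apply: (eq_wf (r1 := xv (trimx a b z *m v))); last exact/we/gv.
  by move=> i; rewrite xv_trimx.
rewrite ev_tri_sub (@dv_tri_sub _ (@euler R)); first exact/ee/gv.
move=> i; rewrite /euler ev_linfield /dot4 !xv_trimx /dot4.
by case: i => [|[|[|[|i]]]] /=; ring.
Qed.

(** The hypotheses say that g(s) = ((A, Z), (0, B)) starts at 1 and satisfies g' = X g = g X with X
    = ((a, zr + i zi), (0, -a)). The form X g gives the derivative along the flow; the form g X
    identifies it with the derivative along X of the pullback of [e] by g(s), again a density, whose
    mean vanishes. *)
Lemma mean_tri_flow (A B : R -> R) (Z : R -> K) (a zr zi : R) e (t : R) :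
  A 0 = 1 -> B 0 = 1 -> Z 0 = 0 -> (forall s, A s != 0) -> (forall s, B s != 0) ->
  (k = RealBase -> zi = 0) ->
  (forall s : R, is_derive s (1 : R) A (a * A s)) ->
  (forall s : R, is_derive s (1 : R) B (- a * B s)) ->
  (forall s : R, is_derive s (1 : R) (fun u : R => Kre (Z u)) (a * Kre (Z s) + zr * B s)) ->
  (forall s : R, is_derive s (1 : R) (fun u : R => Kim (Z u)) (a * Kim (Z s) + zi * B s)) ->
  (forall s : R, a * Kre (Z s) + zr * B s = A s * zr - a * Kre (Z s)) ->
  (forall s : R, a * Kim (Z s) + zi * B s = A s * zi - a * Kim (Z s)) ->
  density e ->
  mean sigma (fun v => ev (xv (trimx (A t) (B t) (Z t) *m v)) e) =
  mean sigma (fun v => ev (xv v) e).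
Proof.
move=> A0 B0 Z0 An0 Bn0 kR dA dB dZr dZi cr ci de.
pose phi s (v : V) := trimx (A s) (B s) (Z s) *m v.
have dNZi (s : R) : is_derive s (1 : R) (fun u : R =>
    - Kim (Z u)) (- (a * Kim (Z s) + zi * B s)).
  exact: is_deriveN.
have d0 (s : R) : is_derive s (1 : R) (fun u : R => 0 : R) 0 by exact: is_derive_cst.
have H (s : R) i j : is_derive s (1 : R)
    (fun u : R => mtri (A u) (B u) (Kre (Z u)) (Kim (Z u)) i j)
    (dot4 (mtri a (- a) zr zi i) (fun l => mtri (A s) (B s) (Kre (Z s)) (Kim (Z s)) l j)).
  case: i => [|[|[|[|i]]]]; case: j => [|[|[|[|j]]]] /=;
    first [apply: (is_derive_eq (dA s)) | apply: (is_derive_eq (dB s)) |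
           apply: (is_derive_eq (dZr s)) | apply: (is_derive_eq (dZi s)) |
           apply: (is_derive_eq (dNZi s)) | apply: (is_derive_eq (d0 s)) ];
    rewrite /dot4 /=; ring.
have wfs s v : S v -> wf (xv (phi s v)) e.
  move=> /sphere_neq0 v0; apply: de.1; apply: unitmx_mul_neq0 => //; exact: trimx_unit.
have dphi (s : R) : is_derive s (1 : R) (fun s : R => mean sigma (fun v =>
    ev (xv (phi s v)) e)) 0.
  apply: (is_derive_eq (mean_flow sigma_inv (phi := phi)
    (fun s v i => xv_trimx (A s) (B s) (Z s) v i) H (wfs s))).
  have [we ee] := density_tri_sub (Z s) (An0 s) (Bn0 s) de.
  rewrite -[RHS](mean_traceless sigma_inv a zr kR (fun v Sv => we v (sphere_neq0 Sv))
    (fun v Sv => ee v (sphere_neq0 Sv))).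
  apply: eq_mean => v _; rewrite (@dv_tri_sub _ (linfield (mtri a (- a) zr zi)))// => i.
  rewrite ev_linfield /dot4 !xv_trimx /dot4.
  (* The upper right entry of g X = X g, real and imaginary part, rewritten as differences equal to
     0. *)
  have cr' := subrr (a * Kre (Z s) + zr * B s); rewrite {1}cr in cr'.
  have ci' := subrr (a * Kim (Z s) + zi * B s); rewrite {1}ci in ci'.
  case: i => [|[|[|[|i]]]] /=; [| |ring|ring|ring]; apply/eqP; rewrite -subr_eq0; apply/eqP.
    transitivity ((A s * zr - a * Kre (Z s) - (a * Kre (Z s) + zr * B s)) * xv v 2 -
      (A s * zi - a * Kim (Z s) - (a * Kim (Z s) + zi * B s)) * xv v 3).
      by rewrite /=; ring.
    by rewrite cr' ci' !mul0r subrr.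
  transitivity ((A s * zr - a * Kre (Z s) - (a * Kre (Z s) + zr * B s)) * xv v 3 +
    (A s * zi - a * Kim (Z s) - (a * Kim (Z s) + zi * B s)) * xv v 2).
    by rewrite /=; ring.
  by rewrite cr' ci' !mul0r addr0.
rewrite [LHS](@is_derive_0_is_cst _ _ t 0 dphi); apply: eq_mean => v _.
rewrite /phi A0 B0 Z0 (_ : trimx _ _ _ = 1%:M) ?mul1mx//.
by apply: matrix2P; rewrite !mxE /= ?Kreal1.
Qed.

Lemma mean_diag (t : R) e : 0 < t -> density e ->
  mean sigma (fun v => ev (xv (trimx t t^-1 0 *m v)) e) =
  mean sigma (fun v => ev (xv v) e).
Proof.
move=> t0 de.
have dE (s : R) : is_derive s (1 : R) (fun u : R => expR (- u)) (- 1 * expR (- s)).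
  apply: (is_derive_eq (is_derive1_comp (is_derive_expR (- s)) (is_deriveNid s 1))).
  by rewrite mulrC.
have := @mean_tri_flow expR (fun s => expR (- s)) (fun=> 0) 1 0 0 e (ln t).
rewrite /= [expR (- ln t)]expRN !lnK ?posrE//; apply=> //.
- exact: expR0.
- by rewrite oppr0 expR0.
- by move=> s; rewrite gt_eqF// expR_gt0.
- by move=> s; rewrite gt_eqF// expR_gt0.
- by move=> s; rewrite mul1r; exact: is_derive_expR.
- by move=> s; apply: (is_derive_eq (is_derive_cst _ _ _)); rewrite Kre0 mul0r mulr0 addr0.
- by move=> s; apply: (is_derive_eq (is_derive_cst _ _ _)); rewrite Kim0 mul0r mulr0 addr0.
- by move=> s; rewrite Kre0; ring.
- by move=> s; rewrite Kim0; ring.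
Qed.

Lemma mean_shear (z : K) e : density e ->
  mean sigma (fun v => ev (xv (trimx 1 1 z *m v)) e) =
  mean sigma (fun v => ev (xv v) e).
Proof.
move=> de.
have := @mean_tri_flow (fun=> 1) (fun=> 1) (fun s => Kreal k s * z) 0 (Kre z) (Kim z) e 1.
have dl := @is_derive_mulr R.
rewrite /= Kreal1 !mul1r; apply=> //.
- by rewrite Kreal0 mul0r.
- by move=> kR; exact: Kim_realbase.
- by move=> s; apply: (is_derive_eq (is_derive_cst _ _ _)); rewrite mul0r.
- by move=> s; apply: (is_derive_eq (is_derive_cst _ _ _)); rewrite oppr0 mul0r.
- move=> s; rewrite (_ : (fun u : R => _) = (fun u : R => u * Kre z)).
    by rewrite mul0r add0r mulr1.
  by apply/funext => u; rewrite KreM Kre_real Kim_real; ring.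
- move=> s; rewrite (_ : (fun u : R => _) = (fun u : R => u * Kim z)).
    by rewrite mul0r add0r mulr1.
  by apply/funext => u; rewrite KimM Kre_real Kim_real; ring.
- by move=> s; ring.
- by move=> s; ring.
Qed.

(** Uses the factorization ((t, z), (0, 1/t)) = ((1, z t), (0, 1)) ((t, 0), (0, 1/t)). *)
Lemma mean_trimx (t : R) (z : K) e : 0 < t -> density e ->
  mean sigma (fun v => ev (xv (trimx t t^-1 z *m v)) e) =
  mean sigma (fun v => ev (xv v) e).
Proof.
move=> t0 de; rewrite -(mean_shear (z * Kreal k t) de).
have dt : density (tri_sub 1 1 (z * Kreal k t) e) by apply: density_tri_sub;
    rewrite ?oner_eq0.
transitivity (mean sigma (fun v => ev (xv v) (tri_sub 1 1 (z * Kreal k t) e))); last first.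
  by apply: eq_mean => v _; rewrite ev_tri_sub.
rewrite -(mean_diag t0 dt); apply: eq_mean => v _; rewrite ev_tri_sub mulmxA.
congr (ev (xv (_ *m _)) _).
have tk0 : Kreal k t != 0 by rewrite Kreal_eq0 gt_eqF.
by apply: matrix2P; rewrite mulmx2E !mxE /= ?KrealV ?Kreal1;
  rewrite ?(mul1r, mulr0, mul0r, addr0, add0r) ?mulfK.
Qed.

End TriangularInvariance.

(** * The lift and its sphere mean *)

Section Homogeneous.
Variables (K : fieldType) (d : nat).
Implicit Types (P : bipoly K) (w : 'I_2 -> K).

Lemma meval2 w P : meval w P =
  \sum_(m <- msupp P) mcoeff m P * (w 0 ^+ m 0 * w 1 ^+ m 1).
Proof.
rewrite mevalE; apply: eq_bigr => m _; rewrite !big_ord_recl big_ord0 mulr1.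
by rewrite (_ : lift ord0 ord0 = 1)//; exact/val_inj.
Qed.

Lemma dehomogE P : dehomog P = \sum_(m <- msupp P) (mcoeff m P)%:P * 'X^(m 0).
Proof.
rewrite /dehomog /mmap; apply: eq_bigr => m _; congr (_ * _).
by rewrite /mmap1 !big_ord_recl big_ord0 mulr1 /= expr1n mulr1.
Qed.

Lemma homog_deg P m : P \is ishomog1 d mdeg -> m \in msupp P -> (m 0%R + m 1%R)%N = d.
Proof.
move=> /dhomogP hP mP; have <- : mdeg m = d := hP m mP;
    rewrite mdegE !big_ord_recl big_ord0 addn0.
by rewrite (_ : lift ord0 ord0 = 1)//; exact/val_inj.
Qed.

Lemma meval_scale c w P : P \is ishomog1 d mdeg ->
  meval (fun i => c * w i) P = c ^+ d * meval w P.
Proof.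
move=> hP; rewrite !meval2 mulr_sumr !big_seq; apply: eq_bigr => m mP.
by rewrite -(homog_deg hP mP) !exprMn exprD; ring.
Qed.

Lemma meval_dehomog x P : meval (fun i => if i == 0 then x else 1) P = (dehomog P).[x].
Proof.
rewrite meval2 dehomogE horner_sum; apply: eq_bigr => m _.
by rewrite /= expr1n mulr1 hornerM hornerC hornerXn.
Qed.

Lemma meval_infty P : P \is ishomog1 d mdeg ->
  meval (fun i => if i == 0 then 1 else 0) P = (dehomog P)`_d.
Proof.
move=> hP; rewrite meval2 dehomogE coef_sum !big_seq; apply: eq_bigr => m mP.
rewrite /= expr1n mul1r coefCM coefXn expr0n -(homog_deg hP mP).
by rewrite -[X in _ = _ * (_ == X)%:R]addn0 eqn_add2l.
Qed.

Lemma size_dehomog P : P \is ishomog1 d mdeg -> (size (dehomog P) <= d.+1)%N.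
Proof.
move=> hP; rewrite dehomogE; apply/leq_sizeP => j dj;
    rewrite coef_sum big_seq big1// => m mP.
rewrite coefCM coefXn gtn_eqF ?mulr0// (leq_trans _ dj)// ltnS -(homog_deg hP mP).
exact: leq_addr.
Qed.

Lemma lift_map_scale (F : bipoly K * bipoly K) (c : K) (v : 'cV[K]_2) :
  F.1 \is ishomog1 d mdeg -> F.2 \is ishomog1 d mdeg ->
  lift_map F (c *: v) = c ^+ d *: lift_map F v.
Proof.
move=> h1 h2; apply/matrixP => i j; rewrite !mxE -meval_scale; last by case: ifP.
by apply: meval_eq => i'; rewrite mxE.
Qed.

(** The dehomogenizations are c p and c q with p / q reduced, and c is constant because f already
    has degree d. A zero of F off the line Y = 0 would be a common root of p and q; one on that line
    would make both degrees smaller than d. *)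
Lemma lift_map_neq0 (f : {fraction {poly K}}) (F : bipoly K * bipoly K) (v : 'cV[K]_2) :
  (2 <= d)%N -> has_degree f d -> homogeneous_lift f d F -> v != 0 ->
  lift_map F v != 0.
Proof.
move=> d2 [p [q [cpq q0 fE dE]]] [h1 h2 _ fF].
set D0 := dehomog F.1 in fF; set D1 := dehomog F.2 in fF.
have p0 : p != 0.
  apply: contraTneq cpq => p0; rewrite p0 coprime0p.
  by apply: contraTN d2 => /eqp_size q1; rewrite dE p0 q1 size_poly0 size_poly1.
(* By the convention x / 0 = 0, a zero denominator would make f zero, whereas p and q are
   nonzero. *)
have D10 : D1 != 0.
  apply/eqP => D10; move: fF; rewrite D10 rmorph0 invr0 mulr0 fE => /eqP.
  by rewrite mulf_eq0 invr_eq0 !tofrac_eq0 (negbTE p0) (negbTE q0).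
have pD : p * D1 = D0 * q.
  apply/eqP; rewrite -tofrac_eq !rmorphM /=; apply/eqP.
  by move: fF; rewrite fE => /eqP; rewrite eqr_div ?tofrac_eq0// => /eqP ->.
have [c cE] : exists c, D1 = c * q.
  by apply/dvdpP; rewrite -(@Gauss_dvdpr _ D1 p q) ?(coprimep_sym q)// pD dvdp_mull.
have D0E : D0 = c * p.
  by apply: (mulIf q0); rewrite -pD cE mulrCA mulrA.
have c0 : c != 0 by apply: contraNneq D10 => c0; rewrite cE c0 mul0r.
have sd : maxn (size p) (size q) = d.+1.
  move: dE; rewrite -(size_poly_gt0 p) -(size_poly_gt0 q) in p0 q0 *.
  by move: p0 q0; case: (size p) (size q) => [|a] [|b]//= _ _ ->; rewrite maxnSS.
have sc : size c = 1%N.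
  have := size_dehomog h1; have := size_dehomog h2;
      rewrite -/D0 -/D1 cE D0E !size_mul// -sd.
  have := size_poly_gt0 c; rewrite c0; case: (size c) => [|[|n]]//= _.
  rewrite !addSn /= !leq_max !(ltnNge (n + size _)) !leq_addl orbF /= -!ltnNge.
  move=> qp /(leq_ltn_trans (leq_addl _ _)) pq.
  by have := ltn_trans (leq_ltn_trans (leq_addl n _) qp) pq; rewrite ltnn.
have [a a0 cC] : exists2 a, a != 0 & c = a%:P.
  exists c`_0; last by apply: size1_polyC; rewrite sc.
  by apply: contraNneq c0 => a0; rewrite (size1_polyC (eq_leq sc)) a0.
have noroot x : ~ (D0.[x] = 0 /\ D1.[x] = 0).
  rewrite D0E cE cC !hornerM !hornerC => -[/eqP + /eqP].
  rewrite !mulf_eq0 (negbTE a0) /= => px qx.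
  by have := coprimep_root cpq px; rewrite (eqP qx) eqxx.
have nolead : ~ (D0`_d = 0 /\ D1`_d = 0).
  rewrite D0E cE cC !coefCM => -[/eqP + /eqP].
  rewrite !mulf_eq0 (negbTE a0) /=.
  have : (size p == d.+1) || (size q == d.+1) by rewrite -sd; case: leqP => _;
      rewrite eqxx ?orbT.
  move=> /orP[]/eqP s.
    by move=> + _; rewrite -[d]/(d.+1.-1) -s -lead_coefE lead_coef_eq0 (negbTE p0).
  by move=> _; rewrite -[d]/(d.+1.-1) -s -lead_coefE lead_coef_eq0 (negbTE q0).
move=> v0; apply/eqP => /matrixP Fv.
have F1 := Fv 0 0; have F2 := Fv 1 0; rewrite !mxE /= in F1 F2.
have [y0|y0] := eqVneq (v 1 0) 0.
  have x0 : v 0 0 != 0.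
    apply: contraNneq v0 => x0; apply/eqP/matrixP => i j.
    by rewrite (ord1 j) mxE; case: (ord2P i) => ->.
  have E (P : bipoly K) : P \is ishomog1 d mdeg -> meval (fun j => v j 0) P = 0 ->
      (dehomog P)`_d = 0.
    move=> hP; rewrite -(meval_infty hP).
    rewrite (@meval_eq _ _ _ (fun i => v 0 0 * (if i == 0 then 1 else 0))); last first.
      by move=> i; case: (ord2P i) => ->; rewrite /= ?mulr1 ?mulr0.
    by rewrite meval_scale// => /eqP; rewrite mulf_eq0 expf_eq0 (negbTE x0) andbF => /eqP.
  by apply: nolead; split; exact: E.
have E (P : bipoly K) : P \is ishomog1 d mdeg -> meval (fun j => v j 0) P = 0 ->
    (dehomog P).[v 0 0 / v 1 0] = 0.
  move=> hP; rewrite -meval_dehomog.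
  rewrite (@meval_eq _ _ _ (fun i => v 1 0 * (if i == 0 then v 0 0 / v 1 0 else
      1))); last first.
    by move=> i; case: (ord2P i) => ->; rewrite /= ?mulr1// mulrC divfK.
  by rewrite meval_scale// => /eqP; rewrite mulf_eq0 expf_eq0 (negbTE y0) andbF => /eqP.
by apply: (noroot (v 0 0 / v 1 0)); split; exact: E.
Qed.

End Homogeneous.

(** * The lift in real coordinates *)

Section LiftExpression.
Variables (R : realType) (k : base).
Local Notation K := (Kfield R k).
Local Notation V := 'cV[K]_2.

Definition polynomial_map (h : V -> K) : Prop := exists er ei : expr R,
  [/\ forall v, ev (xv v) er = Kre (h v), forall v, ev (xv v) ei = Kim (h v),
      forall r, wf r er & forall r, wf r ei].

Lemma polynomial_cst c : polynomial_map (fun=> c).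
Proof. by exists (Cst (Kre c)), (Cst (Kim c)). Qed.

Lemma polynomial_add f g : polynomial_map f -> polynomial_map g ->
  polynomial_map (fun v => f v + g v).
Proof.
move=> [fr [fi [frE fiE wfr wfi]]] [gr [gi [grE giE wgr wgi]]].
exists (Add fr gr), (Add fi gi); split=> //= v.
- by rewrite frE grE KreD.
- by rewrite fiE giE KimD.
Qed.

Lemma polynomial_mul f g : polynomial_map f -> polynomial_map g ->
  polynomial_map (fun v => f v * g v).
Proof.
move=> [fr [fi [frE fiE wfr wfi]]] [gr [gi [grE giE wgr wgi]]].
exists (Add (Mul fr gr) (Opp (Mul fi gi))), (Add (Mul fr gi) (Mul fi gr)); split=> //= v.
- by rewrite frE grE fiE giE KreM mulN1r.
- by rewrite frE grE fiE giE KimM.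
Qed.

Lemma polynomial_exp f n : polynomial_map f -> polynomial_map (fun v => f v ^+ n).
Proof.
move=> pf; elim: n => [|n IH].
  by rewrite (_ : (fun v => _) = (fun=> 1)); [exact: polynomial_cst|apply/funext].
rewrite (_ : (fun v => _) = (fun v => f v * f v ^+ n)); first exact: polynomial_mul.
by apply/funext => v; rewrite exprS.
Qed.

Lemma polynomial_coord i : polynomial_map (fun v => v i 0).
Proof.
case: (ord2P i) => ->; [exists (Var R 0), (Var R 1)|exists (Var R 2), (Var R 3)]; by split.
Qed.

Lemma polynomial_meval (P : bipoly K) : polynomial_map (fun v => meval (fun j => v j 0) P).
Proof.
rewrite (_ : (fun v : V => _) = fun v : V => \sum_(m <- msupp P)
    mcoeff m P * (v 0 0 ^+ m 0 * v 1 0 ^+ m 1)); last first.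
  by apply/funext => v; rewrite meval2.
elim: (msupp P) => [|m s IH].
  rewrite (_ : (fun v : V => _) = (fun=> 0)); first exact: polynomial_cst.
  by apply/funext => v; rewrite big_nil.
rewrite (_ : (fun v : V => _) = (fun v : V => mcoeff m P * (v 0 0 ^+ m 0 * v 1 0 ^+ m 1) +
   \sum_(m <- s) mcoeff m P * (v 0 0 ^+ m 0 * v 1 0 ^+ m 1))); last first.
  by apply/funext => v; rewrite big_cons.
apply: polynomial_add => //; apply: polynomial_mul; first exact: polynomial_cst.
by apply: polynomial_mul; apply: polynomial_exp; exact: polynomial_coord.
Qed.

Lemma lift_expr (F : bipoly K * bipoly K) : exists y : nat -> expr R,
  (forall v i, ev (xv v) (y i) = xv (lift_map F v) i) /\ (forall r i, wf r (y i)).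
Proof.
have [ar [ai [arE aiE war wai]]] := polynomial_meval F.1.
have [br [bi [brE biE wbr wbi]]] := polynomial_meval F.2.
exists (fun i => match i with 0 => ar | 1 => ai | 2 => br | 3 => bi | _ => Cst 0 end).
split=> [v i|r i]; last by case: i => [|[|[|[|i]]]].
by case: i => [|[|[|[|i]]]]; rewrite /= ?arE ?aiE ?brE ?biE /xv ?mxE.
Qed.

End LiftExpression.

(** * The substituted integrand and its homogeneity *)

Section Integrand.
Variables (R : realType) (k : base) (d : nat) (F : bipoly (Kfield R k) * bipoly
    (Kfield R k)).
Local Notation K := (Kfield R k).
Local Notation V := 'cV[K]_2.
Local Notation S := (@Ksphere R k).

Definition Sub (a b : expr R) := Add a (Opp b).

(* |w_0 - z w_1|^2 + t^2 |w_1|^2 = t |gamma^-1 w|^2, the coordinates of w, z, t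
   being the variables o, ..., o + 3, and 8, 9, 10. *)
Definition Aexp (o : nat) : expr R :=
  let w i := Var R (o + i) in
  let zr := Var R 8 in let zi := Var R 9 in let t := Var R 10 in
  let a := Add (Sub (w 0%N) (Mul zr (w 2))) (Mul zi (w 3)) in
  let b := Sub (Sub (w 1%N) (Mul zr (w 3))) (Mul zi (w 2)) in
  Add (Add (Mul a a) (Mul b b))
    (Mul (Mul t t) (Add (Mul (w 2) (w 2)) (Mul (w 3) (w 3)))).

Definition powK (e : expr R) : expr R :=
  match k with RealBase => e | ComplexBase => Mul e e end.

Lemma ev_powK r e : ev r (powK e) = ev r e ^+ Kdeg k.
Proof. by rewrite /powK; case: k => /=; rewrite ?expr1 ?expr2. Qed.

Lemma wf_powK r e : wf r e -> wf r (powK e).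
Proof. by rewrite /powK; case: k. Qed.

(* With w the point of the sphere and F(w) the variables 0-3 and 4-7:
   (log |gamma^-1 F(w)| - d log |gamma^-1 w|) |gamma^-1 w|^(-2[K : R]). *)
Definition hexp : expr R :=
  Mul (Mul (Cst 2^-1) (Sub (Ln (Mul (Aexp 4) (Inv (Var R 10))))
      (Mul (Cst d%:R) (Ln (Mul (Aexp 0) (Inv (Var R 10)))))))
    (powK (Mul (Var R 10) (Inv (Aexp 0)))).

(** The coordinates of F(v) are variables of their own: derivation in z and t touches only 8, 9 and
    10, and F stays inert. *)
Definition env (z : K) (t : R) (v : V) (i : nat) : R :=
  match i with
  | 0 | 1 | 2 | 3 => xv v i
  | 4 => xv (lift_map F v) 0 | 5 => xv (lift_map F v) 1
  | 6 => xv (lift_map F v) 2 | 7 => xv (lift_map F v) 3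
  | 8 => Kre z | 9 => Kim z | 10 => t
  | _ => 0
  end.

Definition Aval (z : K) (t : R) (w : V) : R :=
  let x := xv w in
  (x 0%N - Kre z * x 2 + Kim z * x 3) ^+ 2 + (x 1%N - Kre z * x 3 - Kim z * x 2) ^+ 2
  + t ^+ 2 * (x 2 ^+ 2 + x 3 ^+ 2).

Lemma Aval_gt0 z t w : 0 < t -> w != 0 -> 0 < Aval z t w.
Proof.
move=> t0 w0; have t20 : 0 < t ^+ 2 by rewrite exprn_gt0.
pose a := xv w 0 - Kre z * xv w 2 + Kim z * xv w 3.
pose b := xv w 1 - Kre z * xv w 3 - Kim z * xv w 2.
rewrite /Aval -/a -/b lt0r.
have a0 := sqr_ge0 a; have b0 := sqr_ge0 b.
have c0 : 0 <= xv w 2 ^+ 2 + xv w 3 ^+ 2 by rewrite addr_ge0 ?sqr_ge0.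
have tc0 := mulr_ge0 (ltW t20) c0.
rewrite (addr_ge0 (addr_ge0 a0 b0) tc0) andbT; apply: contraNneq w0 => /eqP.
rewrite (paddr_eq0 (addr_ge0 a0 b0) tc0) (paddr_eq0 a0 b0) (mulf_eq0 (t ^+ 2))
    (gt_eqF t20) /=.
rewrite paddr_eq0 ?sqr_ge0// !sqrf_eq0 /a /b /=.
move=> /andP[/andP[/eqP h0 /eqP h1] /andP[/eqP h2 /eqP h3]].
rewrite h2 h3 !mulr0 ?subr0 ?addr0 in h0 h1.
by rewrite -nsq_eq0 /nsq /= h0 h1 h2 h3 expr0n /= !addr0.
Qed.

Lemma ev_Aexp0 z t v : ev (env z t v) (Aexp 0) = Aval z t v.
Proof. by rewrite /Aval /=; ring. Qed.

Lemma ev_Aexp4 z t v : ev (env z t v) (Aexp 4) = Aval z t (lift_map F v).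
Proof. by rewrite /Aval /=; ring. Qed.

Hypotheses (F1 : F.1 \is ishomog1 d mdeg) (F2 : F.2 \is ishomog1 d mdeg).
Hypothesis F_neq0 : forall v, v != 0 -> lift_map F v != 0.

Definition hval (z : K) (t : R) (v : V) : R :=
  2^-1 * (ln (Aval z t (lift_map F v) / t) - d%:R * ln (Aval z t v / t)) *
  (t / Aval z t v) ^+ Kdeg k.

Lemma ev_hexp z t v : ev (env z t v) hexp = hval z t v.
Proof.
rewrite /hval -(ev_Aexp0 z t v) -(ev_Aexp4 z t v) /hexp [ev _ (Mul _ (powK _))]/= -/ev.
by rewrite ev_powK /= !mulN1r.
Qed.

Lemma wf_hexp z t v : 0 < t -> v != 0 -> wf (env z t v) hexp.
Proof.
move=> t0 v0; have tn0 : t != 0 by rewrite gt_eqF.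
have A0 := Aval_gt0 z t0 v0; have A4 := Aval_gt0 z t0 (F_neq0 v0).
split; last first.
  apply: wf_powK; split=> //; split=> //.
  by rewrite ev_Aexp0 gt_eqF.
split=> //; split; [split; [by split|]|split=> //; split=> //; split; [by split|]].
  change (0 < ev (env z t v) (Aexp 4) * t^-1).
  by rewrite ev_Aexp4 mulr_gt0 ?invr_gt0.
change (0 < ev (env z t v) (Aexp 0) * t^-1).
by rewrite ev_Aexp0 mulr_gt0 ?invr_gt0.
Qed.

Lemma xv_scale (c : R) (v : V) i : xv (Kreal k c *: v) i = c * xv v i.
Proof.
by case: i => [|[|[|[|i]]]]; rewrite /xv ?mulr0// mxE ?KreM ?KimM Kre_real Kim_real; ring.
Qed.

Lemma Aval_scale z t c v : Aval z t (Kreal k c *: v) = c ^+ 2 * Aval z t v.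
Proof. by rewrite /Aval !xv_scale; ring. Qed.

(** As F has degree d, both logarithms are shifted by 2 d ln c and the shifts cancel; only the
    kernel scales. *)
Lemma hval_scale z t (c : R) v : 0 < c -> 0 < t -> v != 0 ->
  c ^+ (2 * Kdeg k) * hval z t (Kreal k c *: v) = hval z t v.
Proof.
move=> c0 t0 v0; have A0 := Aval_gt0 z t0 v0; have A4 := Aval_gt0 z t0 (F_neq0 v0).
have cd0 : 0 < c ^+ d by rewrite exprn_gt0.
rewrite /hval (lift_map_scale _ _ F1 F2) -KrealX !Aval_scale.
rewrite -!(mulrA (_ ^+ 2)) !lnM ?posrE ?exprn_gt0 ?divr_gt0 ?invr_gt0//.
rewrite !lnXn// exprM.
have -> : t / (c ^+ 2 * Aval z t v) = (c ^+ 2)^-1 * (t / Aval z t v).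
  by rewrite invfM mulrCA.
rewrite (exprMn _ (c ^+ 2)^-1) exprVn.
set L := ln c; set p := c ^+ 2 ^+ _; set q := (t / _) ^+ _.
have p0 : p != 0 by rewrite gt_eqF// !exprn_gt0.
rewrite mulrCA mulVKf ?p0//.
by congr (2^-1 * _ * q); rewrite -[L *+ d]mulr_natl; ring.
Qed.

End Integrand.

(** * The mean formula for the triangular representative *)

Section MeanFormula.
Variables (R : realType) (k : base) (d : nat) (F : bipoly (Kfield R k) * bipoly
    (Kfield R k)).
Variable sigma : probability (Kborel R k) R.
Local Notation K := (Kfield R k).
Local Notation V := 'cV[K]_2.
Local Notation S := (@Ksphere R k).
Hypothesis sigma_inv : rotation_invariant sigma.
Let sigmaS : sigma S = 1%E. Proof. by case: sigma_inv. Qed.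
Hypotheses (F1 : F.1 \is ishomog1 d mdeg) (F2 : F.2 \is ishomog1 d mdeg).
Hypothesis F_neq0 : forall v, v != 0 -> lift_map F v != 0.

(** Obtained by differentiating c^n e(c v) = e(v) at c = 1. *)
Lemma euler_of_homog n e (v : V) : wf (xv v) e ->
  (forall c : R, 0 < c -> c ^+ n * ev (xv (Kreal k c *: v)) e = ev (xv v) e) ->
  ev (xv v) (dv (@euler R) e) = - n%:R * ev (xv v) e.
Proof.
move=> we he.
have dl := @is_derive_mulr R.
have d1 i : is_derive (1 : R) (1 : R) (fun c : R => c * xv v i)
    (ev (fun i => 1 * xv v i) (@euler R i)).
  apply: (is_derive_eq (dl _ _)); rewrite /euler ev_linfield /dot4.
  by case: i => [|[|[|[|i]]]] /=; ring.
have we1 : wf (fun i => 1 * xv v i) e by apply: eq_wf we => i; rewrite mul1r.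
have dG := is_derive_ev (r := fun c i => c * xv v i) d1 we1.
have dP := is_deriveM (is_deriveX n (is_derive_id (1 : R) (1 : R))) dG.
have dC : is_derive (1 : R) (1 : R) (cst (ev (xv v) e) : R -> R) 0 by exact: is_derive_cst.
have : is_derive (1 : R) (1 : R) (id ^+ n * (fun u : R => ev (fun i : nat =>
    u * xv v i) e)) 0.
  apply: near_eq_is_derive dC => //; near=> c.
  rewrite -[LHS](he c); last first.
    by near: c; apply: open_nbhs_nbhs; split; [exact: open_gt|exact: ltr01].
  rewrite /= exprfctE; congr (_ * _); apply: eq_ev => i; by rewrite xv_scale.
case: dP => [_ dP] [_]; rewrite dP.
have E : (fun i => 1 * xv v i) =1 xv v by move=> i; rewrite mul1r.
rewrite !(eq_ev _ E) /GRing.scale /= exprfctE expr1n !mul1r !mulr1 => /eqP.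
by rewrite addr_eq0 => /eqP ->; rewrite expr1n mulr1 mulrC mulNr.
Unshelve. all: by end_near. Qed.

(** The matrix [trimx s s^-1 w] belongs to the point (w s, s^2); the identity expresses |gamma^-1
    (gamma v)| = |v|. *)
Lemma Aval_trimx (s : R) (w : K) (v : V) : s != 0 ->
  Aval (w * Kreal k s) (s ^+ 2) (trimx s s^-1 w *m v) = s ^+ 2 * nsq v.
Proof.
by move=> s0; rewrite /Aval /nsq !xv_trimx /dot4 /= KreM KimM Kre_real Kim_real; field.
Qed.

Lemma invmx_trimx (s : R) (w : K) : s != 0 ->
  invmx (trimx s s^-1 w) = trimx s^-1 s (- w).
Proof.
move=> s0; have sk0 : Kreal k s != 0 by rewrite Kreal_eq0.
have gu : trimx s s^-1 w \in unitmx by rewrite trimx_unit// invr_eq0.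
apply: (can_inj (mulKmx gu)); rewrite mulmxV//.
by apply: matrix2P; rewrite mulmx2E !mxE /= ?KrealV;
  rewrite ?(mulr0, mul0r, addr0, add0r) ?mulfV ?mulVf// mulrN mulrC addNr.
Qed.

Lemma nsq_invmx_trimx (s : R) (w : K) (v : V) : s != 0 ->
  nsq (invmx (trimx s s^-1 w) *m v) = Aval (w * Kreal k s) (s ^+ 2) v / s ^+ 2.
Proof.
move=> s0; rewrite invmx_trimx// /Aval /nsq !xv_trimx /dot4 /=.
by rewrite KreN KimN KreM KimM Kre_real Kim_real; field.
Qed.

Lemma ln_sqrt (q : R) : 0 <= q -> ln (Num.sqrt q) = 2^-1 * ln q.
Proof.
rewrite le_eqVlt => /predU1P[<-|q0]; first by rewrite sqrtr0 ln0// mulr0.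
rewrite -[in RHS](sqr_sqrtr (ltW q0)) lnXn ?sqrtr_gt0//.
by rewrite -[ln _ *+ 2]mulr_natl mulKf// pnatr_eq0.
Qed.

(** For v on the sphere, [Aval] at g v equals t, so in [hval] the second logarithm is ln 1 and the
    kernel is 1: the original integrand is the pullback of a density by g, and [mean_trimx] removes
    g. *)
Lemma mean_lift (s : R) (w : K) : 0 < s ->
  let g := trimx s s^-1 w in
  good (fun v => ln (enorm (invmx g *m lift_map F (g *m v)))) /\
  mean sigma (fun v => ln (enorm (invmx g *m lift_map F (g *m v)))) =
  mean sigma (hval d F (w * Kreal k s) (s ^+ 2)).
Proof.
move=> s0 g; have sn0 : s != 0 by rewrite gt_eqF.
pose z := w * Kreal k s; pose t := s ^+ 2.
have t0 : 0 < t by rewrite exprn_gt0.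
have [y [yE wy]] := lift_expr F.
(* Substituting the polynomials of the lift and the constants z, t turns [hexp] into an expression
   in the coordinates of v alone. *)
pose f (i : nat) : expr R :=
  match i with
  | 0 | 1 | 2 | 3 => Var R i
  | 4 => y 0%N | 5 => y 1%N | 6 => y 2 | 7 => y 3
  | 8 => Cst (Kre z) | 9 => Cst (Kim z) | 10 => Cst t | _ => Cst 0
  end.
have fE v : (fun i => ev (xv v) (f i)) =1 env F z t v.
  by do 11 case=> //=; rewrite ?yE.
have wf_f r i : wf r (f i) by move: i; do 11 case=> //=.
pose e := sub f (hexp R k d).
have evE v : ev (xv v) e = hval d F z t v.
  by rewrite /e ev_sub (eq_ev _ (fE v)) ev_hexp.
have de : density k e.
  have we (v : V) : v != 0 -> wf (xv v) e.
    move=> v0; apply: wf_sub => //.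
    refine (eq_wf _ (@wf_hexp _ _ d F F_neq0 z t v t0 v0)) => i.
    by rewrite fE.
  split=> // v v0; rewrite -natrM; apply: euler_of_homog; first exact: we.
  by move=> c c0; rewrite !evE hval_scale.
have gv (v : V) : v != 0 -> g *m v != 0.
  by apply: unitmx_mul_neq0; rewrite trimx_unit// invr_eq0.
have key v : S v -> ln (enorm (invmx g *m lift_map F (g *m v))) = ev (xv (g *m v)) e.
  move=> Sv; have v0 := sphere_neq0 Sv.
  rewrite evE /hval Aval_trimx// (sphereP v).1// mulr1 divff ?gt_eqF// expr1n mulr1.
  rewrite enormE nsq_invmx_trimx// -/z -/t.
  have A0 := Aval_gt0 z t0 (F_neq0 (gv _ v0)).
  rewrite ln1 mulr0 subr0.
  by rewrite ln_sqrt// divr_ge0// ltW.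
split; last first.
  rewrite (eq_mean sigma key) (mean_trimx sigma_inv)//.
  by apply: eq_mean => v _; rewrite evE.
have gg : good (fun v : V => ev (xv v) (tri_sub s s^-1 w e)).
  apply: good_xv => v /sphere_neq0 v0.
  by apply: (density_tri_sub w _ _ de).1 => //; rewrite invr_eq0.
split; last first.
  by have [_ [M bM]] := gg; exists M => v Sv; rewrite key// -ev_tri_sub bM.
(* The identity [key] holds on the sphere only, while measurability is asked on all of K^2; so the
   function itself is written as an expression. *)
pose E := sub f (Mul (Cst 2^-1) (Ln (Mul (Aexp R 4) (Cst t^-1)))).
rewrite (_ : (fun v => _) = (fun v : V => ev (xv v) (tri_sub s s^-1 w E))).
  by apply: measurable_ev => i; exact: measurable_xv.
apply/funext => v; rewrite ev_tri_sub /E ev_sub (eq_ev _ (fE _)).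
change (ln (enorm (invmx g *m lift_map F (g *m v))) =
  2^-1 * ln (ev (env F z t (g *m v)) (Aexp R 4) * t^-1)).
rewrite ev_Aexp4 enormE -nsq_invmx_trimx//.
by rewrite ln_sqrt// nsq_ge0.
Qed.

End MeanFormula.

(** * Cosets of SU_2 and the Iwasawa decomposition *)

Section Quotient.
Variables (R : realType) (k : base) (d : nat) (F : bipoly (Kfield R k) * bipoly
    (Kfield R k)).
Variable sigma : probability (Kborel R k) R.
Local Notation K := (Kfield R k).
Local Notation V := 'cV[K]_2.
Local Notation S := (@Ksphere R k).
Hypothesis sigma_inv : rotation_invariant sigma.
Let sigmaS : sigma S = 1%E. Proof. by case: sigma_inv. Qed.

Lemma SU2_unit (u : 'M[K]_2) : SU2 u -> u \in unitmx.
Proof. by move=> [du _]; rewrite unitmxE du unitr1. Qed.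

Lemma SU2_1 : @SU2 R k 1%:M.
Proof.
split; first by rewrite det1.
by apply: matrix2P; rewrite mulmx2E !mxE /=; apply: eq_Kreim;
  rewrite ?(KreD, KimD, KreM, KimM, Kre_conj, Kim_conj, Kre0, Kim0, Kre1, Kim1); ring.
Qed.

Lemma SU2_mul (u w : 'M[K]_2) : SU2 u -> SU2 w -> SU2 (u *m w).
Proof.
move=> [du uu] [dw ww]; split; first by rewrite det_mulmx du dw mulr1.
by rewrite conj_mulmx trmx_mul -mulmxA (mulmxA _ u) uu mul1mx ww.
Qed.

Lemma SU2_inv (u : 'M[K]_2) : SU2 u -> SU2 (invmx u).
Proof.
move=> su; have uu := SU2_unit su; case: su => du eu; split.
  by rewrite det_inv du invr1.
have E : (map_mx (@Kconj R k) u)^T = invmx u.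
  by rewrite -[LHS]mulmx1 -(mulmxV uu) mulmxA eu mul1mx.
rewrite -E; have -> : map_mx (@Kconj R k) (map_mx (@Kconj R k) u)^T = u^T.
  by apply/matrixP => i j; rewrite !mxE KconjK.
by rewrite trmxK E mulmxV.
Qed.

Lemma SU2_coset_mul (g u : 'M[K]_2) : SU2 u -> SU2_coset (g *m u) = SU2_coset g.
Proof.
move=> su; apply/seteqP; split => _ [w sw <-].
  by exists (u *m w); [exact: SU2_mul|rewrite mulmxA].
exists (invmx u *m w); first by apply: SU2_mul => //; exact: SU2_inv.
by rewrite !mulmxA mulmxK// SU2_unit.
Qed.

(** The chosen representative is g u with u in SU_2: the outer u^-1 preserves the norm, and the
    inner u is absorbed by the invariance of the mean. *)
Lemma RF_mean (g : 'M[K]_2) (h := fun v => ln (enorm (invmx g *m lift_map F (g *m v)))) :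
  g \in unitmx -> good h -> RF sigma F (SU2_coset g) = mean sigma h.
Proof.
move=> gu gh; rewrite /RF.
have : SU2_coset g (xget 1%:M (SU2_coset g)).
  by apply: xgetPex; exists g, 1%:M; [exact: SU2_1|rewrite mulmx1].
case=> u su <-; have uu := SU2_unit su.
rewrite -(mean_SU2 sigma_inv su gh) /sphere_mean /mean; apply: eq_Rintegral => v _.
rewrite /conj_map /h !enormE; congr (ln (Num.sqrt _)).
rewrite -[LHS](nsq_SU2 _ su) -mulmxA; congr (nsq _).
apply: (can_inj (mulKmx gu)).
have guu : g *m u \in unitmx by rewrite unitmx_mul gu.
by rewrite (mulKVmx gu) [LHS]mulmxA (mulKVmx guu).
Qed.

Lemma gamma_mxE (p : 'rV[R]_(Kdeg k).+1) : gamma_mx p =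
  trimx (Num.sqrt (tcoord p)) (Num.sqrt (tcoord p))^-1
    (zcoord p / Kreal k (Num.sqrt (tcoord p))).
Proof. by apply/matrixP => i j; rewrite !mxE KrealV. Qed.

Hypotheses (F1 : F.1 \is ishomog1 d mdeg) (F2 : F.2 \is ishomog1 d mdeg).
Hypothesis F_neq0 : forall v, v != 0 -> lift_map F v != 0.

Lemma RF_coordE p : upper_half p ->
  RF_coord sigma F p = mean sigma (hval d F (zcoord p) (tcoord p)).
Proof.
move=> t0; have s0 : 0 < Num.sqrt (tcoord p) by rewrite sqrtr_gt0.
have sk0 : Kreal k (Num.sqrt (tcoord p)) != 0 by rewrite Kreal_eq0 gt_eqF.
have [gh hE] := mean_lift sigma_inv F1 F2 F_neq0
  (zcoord p / Kreal k (Num.sqrt (tcoord p))) s0.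
rewrite /RF_coord gamma_mxE RF_mean//.
  by rewrite hE divfK// sqr_sqrtr// ltW.
by rewrite trimx_unit ?invr_eq0 ?gt_eqF.
Qed.

Lemma coord_surj (z : K) (t : R) : exists p : 'rV[R]_(Kdeg k).+1,
  zcoord p = z /\ tcoord p = t.
Proof.
clear; rewrite /tcoord; case: k z => [z|[a b]].
  exists (\row_i if i == 0 then z else t); split; first by rewrite /zcoord mxE.
  by rewrite mxE.
exists (\row_i if i == 0 then a else if i == 1 then b else t).
by split; rewrite /zcoord !mxE.
Qed.

Lemma iwasawa (g : 'M[K]_2) : SL2 g ->
  exists2 p, @upper_half R k p & SU2_coset g = SU2_coset (gamma_mx p).
Proof.
move=> dg; pose c := g 1 0; pose e := g 1 1.
pose q := Kre c ^+ 2 + Kim c ^+ 2 + (Kre e ^+ 2 + Kim e ^+ 2).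
have q0 : 0 < q.
  rewrite lt0r !addr_ge0 ?sqr_ge0// andbT; apply/eqP => /eqP.
  rewrite !paddr_eq0 ?addr_ge0 ?sqr_ge0// !sqrf_eq0.
  move=> /andP[/andP[/eqP c1 /eqP c2] /andP[/eqP e1 /eqP e2]].
  have c0 : c = 0 by apply: eq_Kreim; rewrite ?Kre0 ?Kim0.
  have e0 : e = 0 by apply: eq_Kreim; rewrite ?Kre0 ?Kim0.
  move: dg; rewrite /SL2 /= det_mx2 -/c -/e c0 e0 !mulr0 subr0 => /eqP.
  by rewrite eq_sym oner_eq0.
pose r := Num.sqrt q.
have r0 : 0 < r by rewrite sqrtr_gt0.
have rq : r ^+ 2 = q by rewrite sqr_sqrtr// ltW.
have rk0 : Kreal k r != 0 by rewrite Kreal_eq0 gt_eqF.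
(* The bottom row of [su a b] is (c, e) / r, the normalized bottom row of g; hence g times its
   inverse is upper triangular with lower right entry r. *)
pose a := Kconj e * Kreal k r^-1; pose b := c * Kreal k r^-1.
have su1 : SU2 (su a b).
  apply: su_SU2; rewrite !(KreM, KimM) Kre_conj Kim_conj Kre_real Kim_real.
  transitivity (q / r ^+ 2); first by rewrite /q; field; rewrite gt_eqF.
  by rewrite rq divff// gt_eqF.
have gu : forall w, (g *m invmx (su a b)) *m su a b = w -> g = w.
  by move=> w <-; rewrite mulmxKV// SU2_unit.
have iu : invmx (su a b) = su (Kconj a) (- b).
  have uu := SU2_unit su1; apply: (can_inj (mulKmx uu)); rewrite mulmxV//.
  have h : Kconj a * a + Kconj b * b = 1.
    have [d1 _] := su1; rewrite -d1 det_mx2 !mxE /=; ring.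
  apply: matrix2P; rewrite mulmx2E !mxE /= ?KconjN ?KconjK -?h; ring.
have [p [zp tp]] := coord_surj (((g *m invmx (su a b)) 0 1) * Kreal k r^-1) (r ^- 2).
have p0 : 0 < tcoord p by rewrite tp invr_gt0 exprn_gt0.
exists p => //; rewrite -(SU2_coset_mul g (SU2_inv su1)); congr SU2_coset.
rewrite gamma_mxE zp tp.
have -> : Num.sqrt (r ^- 2) = r^-1 by rewrite -exprVn sqrtr_sqr ger0_norm// invr_ge0 ltW.
rewrite -mulrA divff ?Kreal_eq0 ?invr_eq0 ?gt_eqF// mulr1 invrK.
have ce : c * Kconj c + e * Kconj e = Kreal k r * Kreal k r.
  by rewrite mulrC (mulrC e) !KmulJ -KrealD -/q -rq expr2 KrealM.
have h10 : (g *m invmx (su a b)) 1 0 = 0.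
  by rewrite iu mulmx2E !mxE /= -/c -/e /a /b KconjM KconjK Kconj_real; ring.
have h11 : (g *m invmx (su a b)) 1 1 = Kreal k r.
  rewrite iu mulmx2E !mxE /= -/c -/e KconjN opprK KconjK /a /b KconjM Kconj_real.
  rewrite !mulrA -mulrDl ce KrealV.
  by rewrite mulfK.
have h00 : (g *m invmx (su a b)) 0 0 = Kreal k r^-1.
  have : \det (g *m invmx (su a b)) = 1.
    by rewrite det_mulmx dg mul1r; case: (SU2_inv su1).
  rewrite det_mx2 h10 h11 mulr0 subr0 KrealV => h.
  by apply: (mulIf rk0); rewrite h mulVf.
by apply: matrix2P; rewrite ?h00 ?h11 ?h10 !mxE.
Qed.

End Quotient.
(** * Subharmonicity and smoothness *)

Section PointwiseLaplacian.
Variables (R : realType) (k : base) (d : nat).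
Implicit Types (r : nat -> R) (A M N X : expr R) (D : nat -> expr R).

Definition dir (j i : nat) : expr R := Cst (i == j)%:R.

(** On [Aexp o] this is 2 log |gamma^-1 w|, and [ratexp] is |gamma^-1 w|^-2. *)
Definition lnexp A := Ln (Mul A (Inv (Var R 10))).
Definition ratexp A := Mul (Var R 10) (Inv A).

Definition Nd1 j r A : R := ev r (dv (dir j) A) / ev r A - (j == 10)%:R / r 10.
Definition Nd2 j r A : R := ev r (dv (dir j) (dv (dir j) A)) / ev r A
  - (ev r (dv (dir j) A) / ev r A) ^+ 2 + (j == 10)%:R / r 10 ^+ 2.

Lemma dv_lnexp j r A : ev r A != 0 -> r 10 != 0 ->
  ev r (dv (dir j) (lnexp A)) = Nd1 j r A.
Proof.
move=> A0 t0; rewrite /Nd1 [in RHS]eq_sym /=.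
by case: (10 == j)%N; rewrite /=; field; rewrite A0 t0.
Qed.

Lemma dv2_lnexp j r A : ev r A != 0 -> r 10 != 0 ->
  ev r (dv (dir j) (dv (dir j) (lnexp A))) = Nd2 j r A.
Proof.
move=> A0 t0; rewrite /Nd2 [in RHS]eq_sym /=.
by case: (10 == j)%N; rewrite /=; field; rewrite A0 t0.
Qed.

Lemma dv_ratexp j r A : ev r A != 0 -> r 10 != 0 ->
  ev r (dv (dir j) (ratexp A)) = - Nd1 j r A * ev r (ratexp A).
Proof.
move=> A0 t0; rewrite /Nd1 [in RHS]eq_sym /=.
by case: (10 == j)%N; rewrite /=; field; rewrite A0 t0.
Qed.

Lemma dv2_ratexp j r A : ev r A != 0 -> r 10 != 0 ->
  ev r (dv (dir j) (dv (dir j) (ratexp A))) =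
  (Nd1 j r A ^+ 2 - Nd2 j r A) * ev r (ratexp A).
Proof.
move=> A0 t0; rewrite /Nd1 /Nd2 [in RHS]eq_sym /=.
by case: (10 == j)%N; rewrite /=; field; rewrite A0 t0.
Qed.

Lemma dv_powK D r X : ev r (dv D (powK k X)) =
  (Kdeg k)%:R * ev r (dv D X) * ev r X ^+ (Kdeg k).-1.
Proof. by rewrite /powK; case: k => /=; ring. Qed.

(** The last term carries no power of X: the exponent is 0 for K = C, and for K = R its coefficient
    vanishes. *)
Lemma dv2_powK D r X : ev r (dv D (dv D (powK k X))) =
  (Kdeg k)%:R * ev r (dv D (dv D X)) * ev r X ^+ (Kdeg k).-1 +
  (Kdeg k)%:R * (Kdeg k).-1%:R * ev r (dv D X) ^+ 2.
Proof. by rewrite /powK; case: k => /=; ring. Qed.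

Let kp : R := (Kdeg k)%:R.

Lemma dv_hexp j r (A0 := Aexp R 0) (A4 := Aexp R 4)
    (P := 2^-1 * (ev r (lnexp A4) - d%:R * ev r (lnexp A0)))
    (q := ev r (powK k (ratexp A0))) :
  ev r A0 != 0 -> ev r A4 != 0 -> r 10 != 0 ->
  ev r (dv (dir j) (hexp R k d)) =
  q * (2^-1 * (Nd1 j r A4 - d%:R * Nd1 j r A0) - kp * Nd1 j r A0 * P).
Proof.
move=> A00 A40 t0.
have -> : ev r (dv (dir j) (hexp R k d)) =
   2^-1 * (ev r (dv (dir j) (lnexp A4)) - d%:R * ev r (dv (dir j) (lnexp A0))) * q +
   P * ev r (dv (dir j) (powK k (ratexp A0))).
  rewrite /hexp -/A4 -/A0 -/(lnexp A4) -/(lnexp A0) -/(ratexp A0) /P /q.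
  by move: (lnexp A4) (lnexp A0) (powK k _) => a b c /=; ring.
rewrite !dv_lnexp// dv_powK dv_ratexp// /q ev_powK /kp.
by case: k => /=; ring.
Qed.

(** The factor [P] has no definite sign. Its coefficient is the second derivative of the kernel
    divided by the kernel, so [P] drops out of the hyperbolic Laplacian by harmonicity. *)
Lemma dv2_hexp j r (A0 := Aexp R 0) (A4 := Aexp R 4)
    (P := 2^-1 * (ev r (lnexp A4) - d%:R * ev r (lnexp A0)))
    (q := ev r (powK k (ratexp A0))) :
  ev r A0 != 0 -> ev r A4 != 0 -> r 10 != 0 ->
  ev r (dv (dir j) (dv (dir j) (hexp R k d))) =
  q * (2^-1 * (Nd2 j r A4 - d%:R * Nd2 j r A0)
    - kp * Nd1 j r A0 * (Nd1 j r A4 - d%:R * Nd1 j r A0)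
    + (kp ^+ 2 * Nd1 j r A0 ^+ 2 - kp * Nd2 j r A0) * P).
Proof.
move=> A00 A40 t0.
have -> : ev r (dv (dir j) (dv (dir j) (hexp R k d))) =
   2^-1 * (ev r (dv (dir j) (dv (dir j) (lnexp A4))) -
     d%:R * ev r (dv (dir j) (dv (dir j) (lnexp A0)))) * q +
   (ev r (dv (dir j) (lnexp A4)) - d%:R * ev r (dv (dir j) (lnexp A0))) *
     ev r (dv (dir j) (powK k (ratexp A0))) +
   P * ev r (dv (dir j) (dv (dir j) (powK k (ratexp A0)))).
  rewrite /hexp -/A4 -/A0 -/(lnexp A4) -/(lnexp A0) -/(ratexp A0) /P /q.
  by move: (lnexp A4) (lnexp A0) (powK k _) => a b c /=; field.
rewrite !dv_lnexp// !dv2_lnexp// dv2_powK dv_powK dv_ratexp// dv2_ratexp// /q ev_powK /kp.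
by case: k => /=; ring.
Qed.

(** With c = |w_1|^2, the squared gradient in z is 4 c |w_0 - z w_1|^2, and |w_0 - z w_1|^2 = A -
    t^2 c; everything is thus expressed by A, t and c. *)
Lemma Aexp_derivatives o r (A := Aexp R o) (c := r (o + 2)%N ^+ 2 + r (o + 3)%N ^+ 2) :
  o = 0%N \/ o = 4%N ->
  [/\ ev r (dv (dir 8) A) ^+ 2 + ev r (dv (dir 9) A) ^+ 2 =
       4 * c * (ev r A - r 10 ^+ 2 * c),
      ev r (dv (dir 10) A) = 2 * r 10 * c &
      [/\ ev r (dv (dir 8) (dv (dir 8) A)) = 2 * c,
          ev r (dv (dir 9) (dv (dir 9) A)) = 2 * c &
          ev r (dv (dir 10) (dv (dir 10) A)) = 2 * c]].
Proof. by rewrite /A /c => -[] ->; (split; [| |split]); rewrite /=; ring. Qed.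

Lemma Aexp_derivative_real o r : o = 0%N \/ o = 4%N ->
  r (o + 1)%N = 0 -> r (o + 3)%N = 0 -> r 9 = 0 -> ev r (dv (dir 9) (Aexp R o)) = 0.
Proof. by move=> -[] -> /= -> -> ->; ring. Qed.

(* 2 log |gamma^-1 w| has gradient of hyperbolic norm 1 and hyperbolic Laplacian
   [K : R]; Nd1 and Nd2 are its first and second derivatives along a coordinate. *)
Lemma busemann_grad o r : o = 0%N \/ o = 4%N -> r 10 != 0 -> ev r (Aexp R o) != 0 ->
  Nd1 8 r (Aexp R o) ^+ 2 + Nd1 9 r (Aexp R o) ^+ 2 + Nd1 10 r (Aexp R o) ^+ 2 = r 10 ^- 2.
Proof.
move=> oE t0 A0; rewrite /Nd1; have [E1 -> _] := Aexp_derivatives r oE.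
move: E1 A0; move: (ev r (Aexp R o)) (ev r (dv (dir 8) _)) (ev r (dv (dir 9) _)) =>
    A A8 A9 E1 A0.
rewrite /=; set c := r (o + 2)%N ^+ 2 + r (o + 3)%N ^+ 2 in E1 *.
transitivity ((A8 ^+ 2 + A9 ^+ 2) / A ^+ 2 + (2 * r 10 * c / A - 1 / r 10) ^+ 2).
  by field; rewrite A0 t0.
by rewrite E1; field; rewrite A0 t0.
Qed.

Lemma busemann_lap3 o r : o = 0%N \/ o = 4%N -> r 10 != 0 -> ev r (Aexp R o) != 0 ->
  Nd2 8 r (Aexp R o) + Nd2 9 r (Aexp R o) + Nd2 10 r (Aexp R o) - Nd1 10 r (Aexp R o) / r 10
  = 2 * r 10 ^- 2.
Proof.
move=> oE t0 A0; have [E1 E2 [E3 E4 E5]] := Aexp_derivatives r oE;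
    rewrite /Nd1 /Nd2 E2 E3 E4 E5.
move: E1 A0; move: (ev r (Aexp R o)) (ev r (dv (dir 8) _)) (ev r (dv (dir 9) _)) =>
    A A8 A9 E1 A0.
rewrite /=; set c := r (o + 2)%N ^+ 2 + r (o + 3)%N ^+ 2 in E1 *.
transitivity (6 * c / A - (A8 ^+ 2 + A9 ^+ 2) / A ^+ 2 - (2 * r 10 * c / A) ^+ 2 + r 10 ^- 2
   - (2 * r 10 * c / A - 1 / r 10) / r 10).
  by field; rewrite A0 t0.
by rewrite E1; field; rewrite A0 t0.
Qed.

Lemma busemann_lap2 o r : o = 0%N \/ o = 4%N -> r 10 != 0 -> ev r (Aexp R o) != 0 ->
  ev r (dv (dir 9) (Aexp R o)) = 0 ->
  Nd2 8 r (Aexp R o) + Nd2 10 r (Aexp R o) = r 10 ^- 2.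
Proof.
move=> oE t0 A0 E0; have [E1 E2 [E3 E4 E5]] := Aexp_derivatives r oE;
    rewrite /Nd1 /Nd2 E2 E3 E5.
move: E1 A0; rewrite E0; move: (ev r (Aexp R o)) (ev r (dv (dir 8) _)) => A A8 E1 A0.
rewrite /=; set c := r (o + 2)%N ^+ 2 + r (o + 3)%N ^+ 2 in E1 *.
transitivity (4 * c / A - (A8 ^+ 2 + 0 ^+ 2) / A ^+ 2 - (2 * r 10 * c / A) ^+ 2 + r
    10 ^- 2).
  by field; rewrite A0 t0.
by rewrite E1; field; rewrite A0 t0.
Qed.

Lemma hexp_lap_ge0 r : (1 <= d)%N ->
  0 < r 10 -> 0 < ev r (Aexp R 0) -> 0 < ev r (Aexp R 4) ->
  (k = RealBase -> [/\ r 1 = 0, r 3 = 0, r 5 = 0, r 7 = 0 & r 9 = 0]) ->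
  let L j := ev r (dv (dir j) (dv (dir j) (hexp R k d))) in
  0 <= match k with
       | RealBase => r 10 ^+ 2 * (L 8 + L 10)
       | ComplexBase => r 10 ^+ 2 * (L 8 + L 9 + L 10) -
           r 10 * ev r (dv (dir 10) (hexp R k d))
       end.
Proof.
move=> d1 t0 A00 A40 kR.
have tn0 : r 10 != 0 by rewrite gt_eqF.
have A0n0 : ev r (Aexp R 0) != 0 by rewrite gt_eqF.
have A4n0 : ev r (Aexp R 4) != 0 by rewrite gt_eqF.
have q0 : 0 < ev r (powK k (ratexp (Aexp R 0))).
  by rewrite ev_powK exprn_gt0// divr_gt0.
have o0 : 0%N = 0%N \/ 0%N = 4%N by left.
have o4 : 4%N = 0%N \/ 4%N = 4%N by right.
have g0 := busemann_grad o0 tn0 A0n0; have g4 := busemann_grad o4 tn0 A4n0.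
have d1R : 1 <= d%:R :> R by rewrite ler1n.
have T0 : 0 < r 10 ^- 2 by rewrite invr_gt0 exprn_gt0.
have tT : r 10 ^+ 2 * r 10 ^- 2 = 1 by rewrite mulfV// expf_neq0.
lazy beta zeta; rewrite !dv2_hexp// dv_hexp// /kp.
move: q0; set q := ev r (powK _ _); set P := 2^-1 * (ev _ _ - _) => q0.
have l03 := busemann_lap3 o0 tn0 A0n0; have l43 := busemann_lap3 o4 tn0 A4n0.
have l02 := busemann_lap2 o0 tn0 A0n0; have l42 := busemann_lap2 o4 tn0 A4n0.
have z0 : k = RealBase -> ev r (dv (dir 9) (Aexp R 0)) = 0.
  by move=> /kR[h1 h3 _ _ h9]; exact: Aexp_derivative_real.
have z4 : k = RealBase -> ev r (dv (dir 9) (Aexp R 4)) = 0.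
  by move=> /kR[_ _ h5 h7 h9]; exact: Aexp_derivative_real.
have n0 : k = RealBase -> Nd1 9 r (Aexp R 0) = 0 by move=> /z0 h;
    rewrite /Nd1 h !mul0r subrr.
have n4 : k = RealBase -> Nd1 9 r (Aexp R 4) = 0 by move=> /z4 h;
    rewrite /Nd1 h !mul0r subrr.
move: g0 g4 l03 l43 (fun h => l02 (z0 h)) (fun h => l42 (z4 h)) n0 n4.
move: (Nd1 8 r (Aexp R 0)) (Nd1 9 r (Aexp R 0)) (Nd1 10 r (Aexp R 0)) => u8 u9 u10.
move: (Nd1 8 r (Aexp R 4)) (Nd1 9 r (Aexp R 4)) (Nd1 10 r (Aexp R 4)) => v8 v9 v10.
move: (Nd2 8 r (Aexp R 0)) (Nd2 9 r (Aexp R 0)) (Nd2 10 r (Aexp R 0)) => U8 U9 U10.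
move: (Nd2 8 r (Aexp R 4)) (Nd2 9 r (Aexp R 4)) (Nd2 10 r (Aexp R 4)) => V8 V9 V10.
move: tT T0; set T := r 10 ^- 2 => tT T0 gu gv U3 V3 U2 V2 n0 n4.
(* Both gradients have squared length T, so this is 2 u v <= u^2 + v^2 summed over the
   coordinates. *)
have cs : u8 * v8 + u9 * v9 + u10 * v10 <= T.
  have := sqr_ge0 (u8 - v8); have := sqr_ge0 (u9 - v9); have := sqr_ge0 (u10 - v10).
  nra.
have dT : 0 <= (d%:R - 1) * T by rewrite mulr_ge0 ?subr_ge0// ltW.
case: (k) U2 V2 n0 n4 => U2 V2 n0 n4 /=.
  rewrite (n0 erefl) (n4 erefl) in gu gv cs.
  have -> : U10 = T - U8 by rewrite -(U2 erefl); ring.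
  have -> : V10 = T - V8 by rewrite -(V2 erefl); ring.
  (* The coefficient of [P] is |u|^2 - T = 0. What remains is (1 - d) T / 2 - u.v + d T, at least (d
     - 1) T / 2; the complex case gives twice this. *)
  rewrite [leRHS](_ : _ = r 10 ^+ 2 * q * (2^-1 * (1 - d%:R) * T - (u8 * v8 + 0 * 0
      + u10 * v10)
    + d%:R * (u8 ^+ 2 + 0 ^+ 2 + u10 ^+ 2) + (u8 ^+ 2 + 0 ^+ 2 + u10 ^+ 2 - T) *
        P)); last first.
    by field.
  by rewrite gu subrr mul0r addr0 mulr_ge0 ?mulr_ge0 ?sqr_ge0 ?(ltW q0)//; lra.
have -> : U10 = 2 * T - U8 - U9 + u10 / r 10 by rewrite -U3; ring.
have -> : V10 = 2 * T - V8 - V9 + v10 / r 10 by rewrite -V3; ring.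
rewrite [leRHS](_ : _ = r 10 ^+ 2 * q * ((1 - d%:R) * T - 2 * (u8 * v8 + u9 * v9 +
    u10 * v10)
  + 2 * d%:R * (u8 ^+ 2 + u9 ^+ 2 + u10 ^+ 2) + 4 * (u8 ^+ 2 + u9 ^+ 2 + u10 ^+ 2 -
      T) * P)); last first.
  by field.
by rewrite gu subrr mulr0 mul0r addr0 mulr_ge0 ?mulr_ge0 ?sqr_ge0 ?(ltW q0)//; lra.
Qed.

End PointwiseLaplacian.

(** * Derivatives of means over upper half-space *)

Section Smoothness.
Variables (R : realType) (k : base) (d : nat) (F : bipoly (Kfield R k) * bipoly
    (Kfield R k)).
Variable sigma : probability (Kborel R k) R.
Local Notation K := (Kfield R k).
Local Notation V := 'cV[K]_2.
Local Notation S := (@Ksphere R k).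
Local Notation P := 'rV[R]_(Kdeg k).+1.
Local Notation U := (@upper_half R k).
Hypothesis sigmaS : sigma S = 1%E.

Definition penv (p : P) (v : V) : nat -> R := env F (zcoord p) (tcoord p) v.

(* The index in penv of the i-th Euclidean coordinate of upper half-space. *)
Definition pidx (i : 'I_(Kdeg k).+1) : nat := if i == ord_max then 10 else (8 + i)%N.

Lemma Kre_zcoord (p : P) : Kre (zcoord p) = p 0 ord0.
Proof. by move: p; rewrite /zcoord; case: k. Qed.

Lemma penv_line (p : P) (i : 'I_(Kdeg k).+1) (s : R) v j :
  penv (s *: delta_mx 0 i + p) v j = penv p v j + s * (j == pidx i)%:R.
Proof.
have p8 : (8 <= pidx i)%N by rewrite /pidx; case: ifP => // _; exact: leq_addr.
have p10 : (pidx i <= 10)%N.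
  rewrite /pidx; case: ifPn => // _; rewrite -[10%N]/(8 + 2)%N leq_add2l.
  have ik : (i <= Kdeg k)%N by rewrite -ltnS.
  by apply: leq_trans ik _; case: (k).
have [j8|j8] := ltnP j 8.
  rewrite (ltn_eqF (leq_trans j8 p8)) mulr0 addr0 /penv.
  by case: j j8 => //; do 7 (case=> //).
have [j10|j10] := ltnP 10 j.
  rewrite (gtn_eqF (leq_ltn_trans p10 j10)) mulr0 addr0 /penv.
  by move: j10; clear j8; case: j => //; do 10 (case=> //).
have [->|->|->] : [\/ j = 8, j = 9 | j = 10].
  case: j j8 j10 {p8 p10} => [|[|[|[|[|[|[|[|[|[|[|j]]]]]]]]]]] //= _ _;
    by [constructor 1|constructor 2|constructor 3].
- rewrite /penv /= !Kre_zcoord !mxE eqxx /= addrC; congr (_ + _ * _%:R).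
  rewrite /pidx; case: i {p8 p10} => -[|i] /= h; first by case: (k).
  by case: ifP.
- rewrite /penv /= /pidx; move: p i {p8 p10}; rewrite /zcoord; case: k => p i /=.
    by case: i => -[|[|]] //= _; rewrite ?mulr0 ?addr0.
  rewrite !mxE /= addrC; congr (_ + _ * _%:R).
  by case: i => -[|[|[|]]].
- rewrite /penv /= /tcoord !mxE eqxx /= addrC; congr (_ + _ * _%:R).
  rewrite /pidx eq_sym; case: eqP => // ni; rewrite gtn_eqF// -[10%N]/(8 + 2)%N ltn_add2l.
  have ik : (i < Kdeg k)%N.
    by rewrite ltn_neqAle -ltnS ltn_ord andbT; apply/eqP => h; apply: ni; exact/val_inj.
  by apply: leq_trans ik _; case: (k).
Qed.

Lemma admissible_comp (T Q : topologicalType) (r : T -> V -> nat -> R) (f : Q ->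
    T) (q : Q) :
  {for q, continuous f} -> admissible r (f q) -> admissible (fun s => r (f s)) q.
Proof.
move=> cf [cr mr]; split=> [v i Sv|s i]; last exact: mr.
apply: (@continuous_comp _ _ _ (fun x : V * Q => (x.1, f x.2)) (fun x => r x.2 x.1 i)).
  move=> A [[B C] [/= nB nC] BC].
  exists (B, f @^-1` C) => [|x [/= Bx Cx]]; last exact: (BC (x.1, f x.2)).
  by split=> //; exact: cf.
exact: cr.
Qed.

Lemma Kim_zcoord_cont (p : P) : {for p, continuous (fun q : P => Kim (zcoord q))}.
Proof.
have [kE|] : k = RealBase \/ k = ComplexBase by case: (k); [left|right].
  rewrite (_ : (fun q : P => _) = fun=> 0); first exact: cst_continuous.
  by apply/funext => q; rewrite Kim_realbase.
move: p; rewrite /zcoord; case: k => // p _ /=; exact: coord_continuous.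
Qed.

Lemma admissible_penv (p : P) : admissible penv p.
Proof.
have [y [yE wy]] := lift_expr F.
have yc j v : {for v, continuous (fun w : V => xv (lift_map F w) j)}.
  rewrite (_ : (fun w : V => _) = fun w : V => ev (xv w) (y j)); last first.
    by apply/funext => w; rewrite yE.
  by apply: ev_continuous => // i; exact: xv_continuous.
have ym j : measurable_fun setT ((fun w : V => xv (lift_map F w) j) : Kborel R k -> R).
  rewrite (_ : (fun w : V => _) = fun w : V => ev (xv w) (y j)); last first.
    by apply/funext => w; rewrite yE.
  by apply: measurable_ev => i; exact: measurable_xv.
have c1 (h : V -> R) v : {for v, continuous h} -> {for (v, p),
    continuous (fun q : V * P => h q.1)}.
  move=> ch; apply: (@continuous_comp _ _ _ (@fst V P) h); first exact: cvg_fst.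
  exact: ch.
have c2 (h : P -> R) (v : V) : {for p, continuous h} -> {for (v, p),
    continuous (fun q : V * P => h q.2)}.
  move=> ch; apply: (@continuous_comp _ _ _ (@snd V P) h); first exact: cvg_snd.
  exact: ch.
split.
  move=> v i _.
  case: i => [|i]; first exact: (c1 (fun w => xv w 0%N) v (@xv_continuous R k 0 v)).
  case: i => [|i]; first exact: (c1 (fun w => xv w 1%N) v (@xv_continuous R k 1 v)).
  case: i => [|i]; first exact: (c1 (fun w => xv w 2%N) v (@xv_continuous R k 2 v)).
  case: i => [|i]; first exact: (c1 (fun w => xv w 3%N) v (@xv_continuous R k 3 v)).
  case: i => [|i]; first exact: (c1 (fun w => xv (lift_map F w) 0%N) v (yc 0%N v)).
  case: i => [|i]; first exact: (c1 (fun w => xv (lift_map F w) 1%N) v (yc 1%N v)).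
  case: i => [|i]; first exact: (c1 (fun w => xv (lift_map F w) 2%N) v (yc 2%N v)).
  case: i => [|i]; first exact: (c1 (fun w => xv (lift_map F w) 3%N) v (yc 3%N v)).
  case: i => [|i].
    apply: (c2 (fun q => Kre (zcoord q))); rewrite (_ : (fun q : P => _) =
        (fun q : P => q 0 ord0)).
      exact: coord_continuous.
    by apply/funext => q; rewrite Kre_zcoord.
  case: i => [|i]; first by apply: (c2 (fun q => Kim (zcoord q))); exact: Kim_zcoord_cont.
  case: i => [|i]; first by apply: (c2 (fun q => tcoord q)); exact: coord_continuous.
  exact: cst_continuous.
move=> q i; do 4 (case: i => [|i]; first exact: measurable_xv).
do 4 (case: i => [|i]; first exact: ym).
by do 3 (case: i => [|i]; first exact: measurable_cst).
Qed.

Lemma is_derive_line (f : P -> R) (x v : P) (df : R) :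
  is_derive (0 : R) (1 : R) (fun s : R => f (s *: v + x)) df -> is_derive x v f df.
Proof.
have E : (fun h : R => h^-1 *: (((fun s : R => f (s *: v + x)) \o shift 0) (h *: 1) -
     (fun s : R => f (s *: v + x)) 0)) = (fun h : R =>
         h^-1 *: ((f \o shift x) (h *: v) - f x)).
  by apply/funext => h; rewrite /= scale0r add0r addr0 /GRing.scale /= mulr1.
move=> [d1 d2]; split; first by rewrite /derivable -E.
by rewrite /derive -E.
Qed.

Definition pmean (e : expr R) (p : P) : R := mean sigma (fun v => ev (penv p v) e).

Definition wfU (e : expr R) : Prop := forall p v, U p -> S v -> wf (penv p v) e.

Lemma pmean_continuous e p : wfU e -> U p -> {for p, continuous (pmean e)}.
Proof.
by move=> we Up; apply: (mean_continuous sigmaS (admissible_penv p)) => v Sv; exact: we.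
Qed.

(** Partial derivatives act on means as [dv] acts on expressions, so the functions [pmean e] form a
    class closed under differentiation. *)
Lemma pmean_derive e p i : wfU e -> U p ->
  is_derive p (delta_mx 0 i) (pmean e) (pmean (dv (dir R (pidx i)) e) p).
Proof.
move=> we Up; apply: is_derive_line.
pose f (s : R) : P := s *: delta_mx 0 i + p.
have f0 : f 0 = p by rewrite /f scale0r add0r.
have cf : {for 0, continuous f}.
  move=> s; apply: cvgD; last exact: cvg_cst.
  by apply: cvgZr_tmp; exact: cvg_id.
rewrite -[in X in is_derive _ _ _ X]f0.
apply: (@mean_derive R k sigma sigmaS (fun s => penv (f s)) 0 (dir R (pidx i)) e).
- by apply: admissible_comp => //; exact: admissible_penv.
- apply: (@filterE _ (nbhs (0 : R))) => s v j _.
  rewrite (_ : (fun u : R => _) = (fun u : R =>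
      penv p v j + u * (j == pidx i)%:R)); last first.
    by apply/funext => u; rewrite /f penv_line.
  rewrite [ev _ _]/=; move: ((j == pidx i)%:R : R) => c.
  have d1 := is_derive_mulr c s.
  apply: (is_derive_eq (is_deriveD (is_derive_cst (penv p v j) s 1) d1)).
  by rewrite add0r.
- by move=> v Sv; rewrite f0; exact: we.
- by [].
Qed.

Lemma wfU_dv e j : wfU e -> wfU (dv (dir R j) e).
Proof. by move=> we p v Up Sv; apply: wf_dv => //; exact: we. Qed.

Lemma open_upper_half : open U.
Proof.
rewrite (_ : U = (@tcoord R k) @^-1` [set x | 0 < x])//.
by apply: open_comp; [move=> p _; exact: coord_continuous|exact: open_gt].
Qed.

Definition dvs (s : seq 'I_(Kdeg k).+1) (e : expr R) : expr R :=
  foldr (fun i e => dv (dir R (pidx i)) e) e s.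

Lemma wfU_dvs s e : wfU e -> wfU (dvs s e).
Proof. by move=> we; elim: s => //= i s IH; exact: wfU_dv. Qed.

(** The agreement of [f] with a mean is known on the open set [U] only, which suffices since a
    derivative depends on the germ. *)
Lemma partials_pmean (f : P -> R) e s p : (forall p, U p -> f p = pmean e p) -> wfU e ->
  U p -> partials s f p = pmean (dvs s e) p.
Proof.
move=> fE we; elim: s p => [|i s IH] p Up /=; first exact: fE.
rewrite /partial (@near_eq_derive _ _ _ _ (pmean (dvs s e))).
  by have [_] := pmean_derive i (wfU_dvs s we) Up.
by apply: filterS (open_nbhs_nbhs (conj open_upper_half Up)) => q Uq; exact: IH.
Qed.

Lemma smooth_pmean (f : P -> R) e : (forall p, U p -> f p = pmean e p) -> wfU e ->
  smooth_on U f.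
Proof.
move=> fE we s p Up.
have E : \forall q \near p, partials s f q = pmean (dvs s e) q.
  by apply: filterS (open_nbhs_nbhs (conj open_upper_half Up)) => q Uq;
      exact: partials_pmean.
have wes := wfU_dvs s we; split.
  have c := pmean_continuous wes Up.
  have E' : \forall q \near p, pmean (dvs s e) q = partials s f q.
    by apply: filterS E => q ->.
  rewrite /prop_for /continuous_at (nbhs_singleton E).
  exact: (cvg_trans (near_eq_cvg E') c).
move=> i; apply: (@near_eq_derivable _ _ _ (pmean (dvs s e))).
  by apply: filterS E => q ->.
by have [] := pmean_derive i wes Up.
Qed.

End Smoothness.
(** * Properness *)

Section LowerBound.
Variables (R : realType) (k : base) (d : nat) (F : bipoly (Kfield R k) * bipoly
    (Kfield R k)).
Variable sigma : probability (Kborel R k) R.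
Local Notation K := (Kfield R k).
Local Notation V := 'cV[K]_2.
Local Notation S := (@Ksphere R k).
Hypothesis sigma_inv : rotation_invariant sigma.
Let sigmaS : sigma S = 1%E. Proof. by case: sigma_inv. Qed.

(** This is rho^2 for [trimx s s^-1 w], and also for its inverse since the determinant is 1. *)
Definition hs_sqr (s : R) (w : K) : R := s ^+ 2 + (Kre w ^+ 2 + Kim w ^+ 2) + s ^- 2.

Lemma nsq_trimx_le (s : R) (w : K) (v : V) :
  nsq (trimx s s^-1 w *m v) <= hs_sqr s w * nsq v.
Proof.
rewrite /nsq /hs_sqr !xv_trimx /dot4; move: (xv v 0) (xv v 1) (xv v 2) (xv v 3) =>
    x0 x1 x2 x3 /=.
move: (Kre w) (Kim w) => a b; rewrite -exprVn; move: s^-1 => u; rewrite -subr_ge0.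
(* Lagrange's identity: for v = (X, Y) the defect is |w^* X - s Y|^2 + |X / s|^2. *)
rewrite [leRHS](_ : _ = (a * x0 + b * x1 - s * x2) ^+ 2 + (a * x1 - b * x0 - s * x3) ^+ 2
  + (u * x0) ^+ 2 + (u * x1) ^+ 2); last by ring.
by rewrite !addr_ge0 ?sqr_ge0.
Qed.

Lemma nsq_trimx_ge (s : R) (w : K) (v : V) : s != 0 ->
  nsq v <= hs_sqr s w * nsq (trimx s s^-1 w *m v).
Proof.
move=> s0; have su : trimx s s^-1 w \in unitmx by rewrite trimx_unit// invr_eq0.
rewrite -{1}(mulKmx su v) invmx_trimx//.
have := nsq_trimx_le s^-1 (- w) (trimx s s^-1 w *m v).
rewrite invrK (_ : hs_sqr s^-1 (- w) = hs_sqr s w)// /hs_sqr KreN KimN !sqrrN exprVn invrK.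
by rewrite addrAC [RHS]addrAC (addrC (s ^- 2)).
Qed.

Lemma nsq_invmx_ge (s : R) (w : K) (v : V) : s != 0 ->
  nsq v <= hs_sqr s w * nsq (invmx (trimx s s^-1 w) *m v).
Proof.
move=> s0; have su : trimx s s^-1 w \in unitmx by rewrite trimx_unit// invr_eq0.
by rewrite -{1}(mulKVmx su v); exact: nsq_trimx_le.
Qed.

Lemma hs_sqr_ge2 (s : R) (w : K) : s != 0 -> 2 <= hs_sqr s w.
Proof.
move=> s0; have h : s * s^-1 = 1 by rewrite mulfV.
rewrite /hs_sqr -exprVn; have := sqr_ge0 (Kre w); have := sqr_ge0 (Kim w).
have := sqr_ge0 (s - s^-1); nra.
Qed.

Definition x0sq (v : V) : R := xv v 0 ^+ 2 + xv v 1 ^+ 2.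

(* The longer row of gamma can be rotated into a multiple of (1, 0). *)
Lemma rotate_row (s : R) (w : K) : 0 < s ->
  exists2 u, SU2 u & forall v, hs_sqr s w / 2 * x0sq v <= nsq (trimx s s^-1 w *m (u *m v)).
Proof.
move=> s0; pose eta := s ^+ 2 + (Kre w ^+ 2 + Kim w ^+ 2).
have [le|lt] := leP (s ^- 2) eta; last first.
  (* The bottom row (0, 1/s) is the longer one; a quarter turn makes it act on the first
     coordinate. *)
  exists (su 0 1); first by apply: su_SU2; rewrite Kre0 Kim0 Kre1 Kim1; ring.
  move=> v; rewrite /nsq /x0sq !xv_trimx /dot4 !xv_su /dot4.
  move: (xv v 0) (xv v 1) (xv v 2) (xv v 3) => x0 x1 x2 x3.
  rewrite /= Kre0 Kim0 Kre1 Kim1.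
  have h : hs_sqr s w <= 2 * s ^- 2 by rewrite /hs_sqr -/eta; lra.
  have x0s : 0 <= x0 ^+ 2 + x1 ^+ 2 by rewrite addr_ge0 ?sqr_ge0.
  apply: (@le_trans _ _ (s ^- 2 * (x0 ^+ 2 + x1 ^+ 2))).
    by rewrite ler_wpM2r// ler_pdivrMr// mulrC.
  rewrite -[leRHS]addrA -[leLHS]add0r lerD ?addr_ge0 ?sqr_ge0//.
  by rewrite -exprVn le_eqVlt; apply/orP; left; apply/eqP; ring.
have eta0 : 0 < eta by rewrite ltr_pwDl ?exprn_gt0// addr_ge0 ?sqr_ge0.
pose e := Num.sqrt eta; have e0 : 0 < e by rewrite sqrtr_gt0.
have ee : e ^+ 2 = eta by rewrite sqr_sqrtr// ltW.
(* The first column is the conjugate of the row (s, w) divided by its length e, so the rotated row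
   is (e, 0). *)
exists (su (Kreal k (s / e)) (Kconj w * Kreal k e^-1)).
  apply: su_SU2; rewrite KreM KimM Kre_conj Kim_conj !Kre_real !Kim_real.
  transitivity (eta / e ^+ 2); first by rewrite /eta; field; rewrite gt_eqF.
  by rewrite ee divff// gt_eqF.
move=> v; apply: (@le_trans _ _ (eta * x0sq v)).
  rewrite ler_wpM2r ?addr_ge0 ?sqr_ge0// ler_pdivrMr// /hs_sqr -/eta; lra.
rewrite /nsq /x0sq !xv_trimx /dot4 !xv_su /dot4.
move: (xv v 0) (xv v 1) (xv v 2) (xv v 3) => x0 x1 x2 x3.
rewrite !KreM !KimM Kre_conj Kim_conj !Kre_real !Kim_real /=.
rewrite -[leRHS]addrA -[leLHS]addr0 lerD ?addr_ge0 ?sqr_ge0//.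
rewrite -[in leLHS]ee le_eqVlt; apply/orP; left; apply/eqP.
have E : e = (s ^+ 2 + (Kre w ^+ 2 + Kim w ^+ 2)) / e by rewrite -/eta -ee; field;
    rewrite gt_eqF.
transitivity ((e * x0) ^+ 2 + (e * x1) ^+ 2); first by ring.
by rewrite {1 2}E; congr (_ ^+ 2 + _ ^+ 2); field; rewrite gt_eqF.
Qed.

(** Two values below 1/50 would add up to less than 1/25, so at most one index is bad. It
    contributes at least - L, the other four at least L - c each. *)
Lemma five_sum (f1 f2 f3 f4 f5 g1 g2 g3 g4 g5 L c : R) :
  1/25 <= f1 + f2 -> 1/25 <= f1 + f3 -> 1/25 <= f1 + f4 -> 1/25 <= f1 + f5 ->
  1/25 <= f2 + f3 -> 1/25 <= f2 + f4 -> 1/25 <= f2 + f5 ->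
  1/25 <= f3 + f4 -> 1/25 <= f3 + f5 -> 1/25 <= f4 + f5 ->
  - L <= g1 -> - L <= g2 -> - L <= g3 -> - L <= g4 -> - L <= g5 ->
  (1/50 <= f1 -> L - c <= g1) -> (1/50 <= f2 -> L - c <= g2) ->
  (1/50 <= f3 -> L - c <= g3) -> (1/50 <= f4 -> L - c <= g4) ->
  (1/50 <= f5 -> L - c <= g5) ->
  3 * L - 4 * c <= g1 + g2 + g3 + g4 + g5.
Proof.
move=> f12 f13 f14 f15 f23 f24 f25 f34 f35 f45 l1 l2 l3 l4 l5 h1 h2 h3 h4 h5.
have hl (x y : R) : 1/25 <= x + y -> x < 1/50 -> 1/50 <= y by lra.
have [b1|b1] := ltP f1 (1/50).
  have := h2 (hl _ _ f12 b1).
  have := h3 (hl _ _ f13 b1).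
  have := h4 (hl _ _ f14 b1).
  have := h5 (hl _ _ f15 b1).
  by move: l1; clear; lra.
have [b2|b2] := ltP f2 (1/50).
  have := h1 b1.
  have := h3 (hl _ _ f23 b2).
  have := h4 (hl _ _ f24 b2).
  have := h5 (hl _ _ f25 b2).
  by move: l2; clear; lra.
have [b3|b3] := ltP f3 (1/50).
  have := h1 b1.
  have := h2 b2.
  have := h4 (hl _ _ f34 b3).
  have := h5 (hl _ _ f35 b3).
  by move: l3; clear; lra.
have [b4|b4] := ltP f4 (1/50).
  have := h1 b1.
  have := h2 b2.
  have := h3 b3.
  have := h5 (hl _ _ f45 b4).
  by move: l4; clear; lra.
have := h1 b1.
have := h2 b2.
have := h3 b3.
have := h4 b4.
by move: l5; clear; lra.
Qed.

Definition rot (c e : R) : 'M[K]_2 := su (Kreal k c) (Kreal k e).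

Lemma rot_SU2 (c e : R) : c ^+ 2 + e ^+ 2 = 1 -> SU2 (rot c e).
Proof. by move=> ce; apply: su_SU2; rewrite !Kre_real !Kim_real -ce; ring. Qed.

Lemma x0sq_rot (c e : R) (v : V) :
  x0sq (rot c e *m v) = (c * xv v 0 - e * xv v 2) ^+ 2 + (c * xv v 1 - e * xv v 3) ^+ 2.
Proof. by rewrite /x0sq !xv_su /dot4 /= !Kre_real !Kim_real; ring. Qed.

Lemma le_ln (x y : R) : 0 < x -> x <= y -> ln x <= ln y.
Proof. by move=> x0 xy; rewrite ler_ln ?posrE// (lt_le_trans x0). Qed.

(** The squared components along two unit vectors with inner product al add up to a quadratic form
    with eigenvalues 1 - al and 1 + al, both at least 1/25 here; it is applied to (x0, x2) and to
    (x1, x3). *)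
Lemma pair_sum (c e c' e' x0 x1 x2 x3 : R) : x0 ^+ 2 + x1 ^+ 2 + x2 ^+ 2 + x3 ^+ 2 = 1 ->
  c ^+ 2 + e ^+ 2 = 1 -> c' ^+ 2 + e' ^+ 2 = 1 ->
  c * c' + e * e' <= 24 / 25 -> - (24 / 25) <= c * c' + e * e' ->
  1 / 25 <= (c * x0 - e * x2) ^+ 2 + (c * x1 - e * x3) ^+ 2
    + ((c' * x0 - e' * x2) ^+ 2 + (c' * x1 - e' * x3) ^+ 2).
Proof.
move=> v1 ce ce' u1 u2.
have key x y : (x ^+ 2 + y ^+ 2) / 25 <= (c * x - e * y) ^+ 2 + (c' * x - e' * y) ^+ 2.
  pose p := c * x - e * y; pose q := e * x + c * y.
  pose al := c * c' + e * e'; pose be := c * e' - e * c'.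
  have ab : al ^+ 2 + be ^+ 2 = 1.
    by rewrite -[RHS]mulr1 -{1}ce -ce' /al /be; ring.
  have pq : x ^+ 2 + y ^+ 2 = p ^+ 2 + q ^+ 2.
    by rewrite -[LHS]mul1r -ce /p /q; ring.
  have E : c' * x - e' * y = al * p - be * q.
    rewrite -[LHS]mul1r -ce /al /be /p /q; ring.
  rewrite E -/p pq; rewrite -/al in u1 u2.
  move: ab pq E; move: p q al be u1 u2 => p q al be u1 u2 ab _ _.
  pose m := al * p - be * q; rewrite -/m.
  have b2 : be ^+ 2 = (1 - al) * (1 + al) by rewrite -[be ^+ 2](addKr (al ^+ 2)) ab; ring.
  have b0 : 0 < be ^+ 2 by rewrite b2 mulr_gt0//; lra.
  rewrite -subr_ge0 -(pmulr_rge0 _ b0).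
  (* Diagonalization in p + m and p - m; the factor be^2 = 1 - al^2 > 0 clears the denominator left
     by eliminating q. *)
  have -> : be ^+ 2 * (p ^+ 2 + m ^+ 2 - (p ^+ 2 + q ^+ 2) / 25) =
      (1 - al) * (1 + al - 1 / 25) / 2 * (p + m) ^+ 2 +
      (1 + al) * (1 - al - 1 / 25) / 2 * (p - m) ^+ 2.
    transitivity (be ^+ 2 * (p ^+ 2 + m ^+ 2 - p ^+ 2 / 25) - (al * p - m) ^+ 2 / 25).
      by rewrite /m; field.
    by rewrite b2; field.
  by rewrite addr_ge0// mulr_ge0 ?sqr_ge0// mulr_ge0// mulr_ge0//; lra.
have h1 := key x0 x2; have h2 := key x1 x3; lra.
Qed.

(* Five rotations, for at most one of which the first coordinate is small: the
   average of log |gamma v|^2 over them controls its mean over the sphere. *)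
Lemma mean_ln_nsq (s : R) (w : K) (g := fun v : V => ln (nsq (trimx s s^-1 w *m v))) :
  0 < s -> good g /\ 3 / 5 * ln (hs_sqr s w) - 4 / 5 * ln 100 <= mean sigma g.
Proof.
move=> s0; have sn0 : s != 0 by rewrite gt_eqF.
have h2 := hs_sqr_ge2 w sn0; have h0 : 0 < hs_sqr s w by lra.
have gu (v : V) : v != 0 -> trimx s s^-1 w *m v != 0.
  by move=> v0; apply: unitmx_mul_neq0 => //; rewrite trimx_unit// invr_eq0.
pose E := Ln (dotE (Var R) (Var R)).
have EE (v : V) : ev (xv v) E = ln (nsq v).
  by rewrite /E /nsq /= -!expr2.
have gg : good g.
  rewrite (_ : g = fun v : V => ev (xv v) (tri_sub s s^-1 w E)); last first.
    by apply/funext => v; rewrite ev_tri_sub EE.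
  apply: good_xv => v /sphere_neq0 v0; apply: wf_sub => //; split=> //.
  rewrite -/(ev _ _) (_ : ev _ _ = nsq (trimx s s^-1 w *m v)) ?nsq_gt0 ?gu//.
  by rewrite /nsq !xv_trimx /= !expr2.
split=> //; have [u su hu] := rotate_row w s0.
(* Unit vectors built from the triple 3, 4, 5. The closest two lines, along (3/5, 4/5) and (4/5,
   3/5), have cosine 24/25, whence the bound 1/25 for pairs and the threshold 1/50. *)
pose c (j : nat) : R := match j with 0 => 1 | 1 => 0 | 2 => 3/5 | 3 => 4/5 | _ => 3/5 end.
pose e (j : nat) : R := match j with 0 => 0 | 1 => 1 | 2 => 4/5 | 3 => 3/5 | _ =>
    -(4/5) end.
have ce j : SU2 (rot (c j) (e j)).
  by apply: rot_SU2; case: j => [|[|[|[|j]]]]; rewrite /c /e; field.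
pose G j (v : V) := g (u *m (rot (c j) (e j) *m v)).
have GE j : mean sigma (G j) = mean sigma g.
  rewrite -(mean_SU2 sigma_inv (SU2_mul su (ce j)) gg).
  by apply: eq_mean => v _; rewrite /G mulmxA.
have gG j : good (G j).
  have := good_mulmx (SU2_mul su (ce j)) gg.
  by rewrite (_ : (fun v => _) = G j)//; apply/funext => v; rewrite /G mulmxA.
have step : 3 * ln (hs_sqr s w) - 4 * ln 100 <=
    mean sigma (fun v => G 0%N v + G 1%N v + G 2 v + G 3 v + G 4 v).
  rewrite -[leLHS](mean_cst sigmaS); apply: (le_mean sigmaS) => //.
  - exact: good_cst.
  - by do !apply: goodD.
  move=> v /sphereP v1; pose f j := x0sq (rot (c j) (e j) *m v).
  have l j : - ln (hs_sqr s w) <= G j v.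
    rewrite /G /g -lnV ?posrE//; apply: le_ln; first by rewrite invr_gt0.
    rewrite -[leLHS]mulr1 ler_pdivrMl//; apply: le_trans (nsq_trimx_ge _ _ sn0).
    by rewrite (nsq_SU2 _ su) (nsq_SU2 _ (ce j)) v1.
  (* The constant 100 is the threshold 1/50 combined with the factor 1/2 of [rotate_row]. *)
  have lg j : 1 / 50 <= f j -> ln (hs_sqr s w) - ln 100 <= G j v.
    move=> fj; rewrite /G /g -ln_div ?posrE//; apply: le_ln; first by rewrite divr_gt0.
    apply: le_trans (hu _); rewrite -/(f j).
    have : 0 <= hs_sqr s w * (f j - 1 / 50) by rewrite mulr_ge0 ?subr_ge0// ltW.
    by lra.
  by apply: (@five_sum (f 0%N) (f 1%N) (f 2) (f 3) (f 4)) => //;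
    first [exact: l | exact: lg |
      rewrite /f !x0sq_rot; apply: (pair_sum v1); rewrite /c /e /=; first [lra|by field]].
have g01 := goodD (gG 0%N) (gG 1%N); have g012 := goodD g01 (gG 2).
have g0123 := goodD g012 (gG 3).
move: step; rewrite (meanD sigmaS g0123 (gG 4)) (meanD sigmaS g012 (gG 3)).
rewrite (meanD sigmaS g01 (gG 2)) (meanD sigmaS (gG 0%N) (gG 1%N)).
rewrite (GE 0%N) (GE 1%N) (GE 2) (GE 3) (GE 4).
by clear; lra.
Qed.

(** The constant is the minimum of |F|^2 on the sphere, positive since F does not vanish there;
    homogeneity extends the bound to K^2. *)
Lemma lift_lower_bound (F1 : F.1 \is ishomog1 d mdeg) (F2 : F.2 \is ishomog1 d mdeg)
    (F_neq0 : forall v, v != 0 -> lift_map F v != 0) :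
  exists2 m : R, 0 < m & forall v, v != 0 -> m * nsq v ^+ d <= nsq (lift_map F v).
Proof.
have [y [yE wy]] := lift_expr F.
have cF : {within S, continuous (fun v => nsq (lift_map F v))}.
  apply: continuous_subspaceT => v.
  rewrite (_ : (fun w : V => _) = (fun w : V => ev (xv w) (dotE y y))); last first.
    by apply/funext => w; rewrite /nsq /dotE /= !yE !expr2.
  by apply: ev_continuous => [i|]; [exact: xv_continuous|rewrite /dotE /=].
have [c cS cmin] := compact_EVT_min (@sphere_nonempty R k) (@compact_sphere R k) cF.
exists (nsq (lift_map F c)).
  by rewrite nsq_gt0; apply: F_neq0; apply: sphere_neq0; exact: set_mem.
move=> v v0; pose r := Num.sqrt (nsq v).
have r0 : 0 < r by rewrite sqrtr_gt0 nsq_gt0.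
have rr : r ^+ 2 = nsq v by rewrite sqr_sqrtr// nsq_ge0.
have scale (a : R) (u : V) : nsq (Kreal k a *: u) = a ^+ 2 * nsq u.
  by rewrite /nsq !xv_scale; ring.
pose u := Kreal k r^-1 *: v.
have uS : S u by apply/sphereP; rewrite /u scale -rr -exprMn mulVf ?gt_eqF// expr1n.
have vE : v = Kreal k r *: u.
  by rewrite /u scalerA -KrealM divff ?gt_eqF// Kreal1 scale1r.
rewrite -rr [in leRHS]vE (lift_map_scale _ _ F1 F2) -KrealX scale.
rewrite [X in _ * X <= _](_ : _ = (r ^+ d) ^+ 2) -?exprM; last by rewrite mulnC.
by rewrite mulrC; apply: ler_wpM2l; [rewrite exprn_ge0// ltW|apply: cmin; exact: mem_set].
Qed.

(** With L = ln rho^2 the bounds combine to (3 d / 5 - 1) L / 2 up to a constant. As L >= 0 and d >=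
    2 this is at least L / 10. *)
Lemma mean_lift_lower_bound (F1 : F.1 \is ishomog1 d mdeg) (F2 : F.2 \is ishomog1 d mdeg)
    (F_neq0 : forall v, v != 0 -> lift_map F v != 0) : (2 <= d)%N ->
  exists C : R, forall (s : R) (w : K), 0 < s ->
    let g := trimx s s^-1 w in
    ln (hs_sqr s w) / 10 - C <= mean sigma (fun v =>
        ln (enorm (invmx g *m lift_map F (g *m v)))).
Proof.
move=> d2; have [m m0 mF] := lift_lower_bound F1 F2 F_neq0.
exists (2^-1 * (d%:R * (4 / 5 * ln 100) - ln m)) => s w s0; lazy zeta.
have sn0 : s != 0 by rewrite gt_eqF.
have [gl _] := mean_lift sigma_inv F1 F2 F_neq0 w s0; lazy zeta in gl.
have [gn bn] := mean_ln_nsq w s0.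
set g := trimx s s^-1 w in gl gn bn *.
have h2 := hs_sqr_ge2 w sn0; have h0 : 0 < hs_sqr s w by lra.
have ggl := goodZ d%:R gn.
pose L := ln (hs_sqr s w); pose h v := 2^-1 * (ln m - L + d%:R * ln (nsq (g *m v))).
have gh : good h by apply: goodZ; apply: goodD => //; exact: good_cst.
have le1 : mean sigma h <= mean sigma (fun v =>
    ln (enorm (invmx g *m lift_map F (g *m v)))).
  apply: (le_mean sigmaS) => // v /sphere_neq0 v0.
  have gv0 : g *m v != 0 by apply: unitmx_mul_neq0 => //; rewrite trimx_unit// invr_eq0.
  have n0 : 0 < nsq (g *m v) by rewrite nsq_gt0.
  rewrite enormE ln_sqrt ?nsq_ge0// /h ler_wpM2l ?invr_ge0//.
  rewrite mulr_natl -lnXn// -ln_div ?posrE// -lnM ?posrE ?divr_gt0 ?exprn_gt0//.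
  apply: le_ln; first by rewrite mulr_gt0 ?divr_gt0 ?exprn_gt0.
  rewrite mulrAC ler_pdivrMr// [leRHS]mulrC.
  by apply: (le_trans _ (nsq_invmx_ge w _ sn0)); exact: mF.
apply: le_trans le1; rewrite /h (meanZ sigmaS); last by apply: goodD => //; exact: good_cst.
rewrite (meanD sigmaS (good_cst k (ln m - L)) ggl) (mean_cst sigmaS) (meanZ sigmaS _ gn).
have L0 : 0 <= L by rewrite ln_ge0//; lra.
have d2R : 2 <= d%:R :> R by rewrite ler_nat.
have : d%:R * (3 / 5 * L - 4 / 5 * ln 100) <= d%:R * mean sigma (fun v =>
    ln (nsq (g *m v))).
  by rewrite ler_wpM2l.
have : 0 <= (d%:R - 2) * L by rewrite mulr_ge0 ?subr_ge0.
rewrite -/L; lra.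
Qed.

End LowerBound.
Lemma hyp_laplacianE (R : realType) (k : base) (g : 'rV[R]_(Kdeg k).+1 -> R)
    (p : 'rV[R]_(Kdeg k).+1) (L : nat -> R) (D : R) :
  (forall i, partials [:: i; i] g p = L (pidx i)) -> partial ord_max g p = D ->
  hyp_laplacian g p =
  match k with
  | RealBase => tcoord p ^+ 2 * (L 8 + L 10)
  | ComplexBase => tcoord p ^+ 2 * (L 8 + L 9 + L 10) - tcoord p * D
  end.
Proof.
case: k g p => g p Lg Dg; rewrite /hyp_laplacian /laplacian ?Dg !big_ord_recl big_ord0 !Lg.
  by rewrite addr0.
by rewrite addr0 addrA.
Qed.

Lemma coord_sqr_le (R : realType) (k : base) (p : 'rV[R]_(Kdeg k).+1) i : i != ord_max ->
  p 0 i ^+ 2 <= Kre (zcoord p) ^+ 2 + Kim (zcoord p) ^+ 2.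
Proof.
case: k p i => p i ni /=.
  rewrite [0 ^+ 2]expr0n addr0 (_ : i = 0)//.
  by apply/val_inj; case: i ni => -[|[|]].
have [->|->] : i = 0 \/ i = 1.
  by case: i ni => -[|[|[|//]]] h ni //; [left|right]; exact/val_inj.
  by rewrite lerDl sqr_ge0.
by rewrite lerDr sqr_ge0.
Qed.

(** * The four assertions for the sphere mean *)

Section MainProof.
Variables (R : realType) (k : base) (d : nat) (F : bipoly (Kfield R k) * bipoly
    (Kfield R k)).
Variable sigma : probability (Kborel R k) R.
Local Notation K := (Kfield R k).
Local Notation V := 'cV[K]_2.
Local Notation S := (@Ksphere R k).
Local Notation P := 'rV[R]_(Kdeg k).+1.
Local Notation U := (@upper_half R k).
Hypothesis sigma_inv : rotation_invariant sigma.
Let sigmaS : sigma S = 1%E. Proof. by case: sigma_inv. Qed.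
Hypotheses (F1 : F.1 \is ishomog1 d mdeg) (F2 : F.2 \is ishomog1 d mdeg).
Hypothesis F_neq0 : forall v, v != 0 -> lift_map F v != 0.
Hypothesis d2 : (2 <= d)%N.

Lemma RF_coord_pmean p : U p -> RF_coord sigma F p = pmean F sigma (hexp R k d) p.
Proof.
move=> Up; rewrite (RF_coordE sigma_inv F1 F2 F_neq0 Up).
by apply: eq_mean => v _; rewrite /penv ev_hexp.
Qed.

Lemma wfU_hexp : wfU F (hexp R k d).
Proof. by move=> p v Up /sphere_neq0 v0; exact: wf_hexp. Qed.

Lemma RF_smooth : smooth_on U (RF_coord sigma F).
Proof. exact: (smooth_pmean sigmaS RF_coord_pmean wfU_hexp). Qed.

Lemma RF_continuous p : U p -> {for p, continuous (RF_coord sigma F)}.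
Proof. by move=> Up; have [] := RF_smooth [::] Up. Qed.

(** The base [b] of the match is kept apart from [k], on which the types depend, so that cases can
    be distinguished. *)
Lemma mean_combination (b : base) (a c : R) (f8 f9 f10 g : V -> R) :
  good f8 -> good f9 -> good f10 -> good g ->
  match b with
  | RealBase => a * (mean sigma f8 + mean sigma f10)
  | ComplexBase => a * (mean sigma f8 + mean sigma f9 + mean sigma f10) - c * mean sigma g
  end =
  mean sigma (fun v => match b with
  | RealBase => a * (f8 v + f10 v)
  | ComplexBase => a * (f8 v + f9 v + f10 v) - c * g v
  end).
Proof.
move=> h8 h9 h10 hg; case: b.
  by rewrite (meanZ sigmaS _ (goodD h8 h10)) (meanD sigmaS h8 h10).
rewrite (meanB sigmaS (goodZ a (goodD (goodD h8 h9) h10)) (goodZ c hg)).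
rewrite (meanZ sigmaS _ (goodD (goodD h8 h9) h10)) (meanZ sigmaS _ hg).
by rewrite (meanD sigmaS (goodD h8 h9) h10) (meanD sigmaS h8 h9).
Qed.

Lemma RF_subharmonic p : U p -> 0 <= hyp_laplacian (RF_coord sigma F) p.
Proof.
move=> Up; pose L j := pmean F sigma (dv (dir R j) (dv (dir R j) (hexp R k d))) p.
have LE i : partials [:: i; i] (RF_coord sigma F) p = L (pidx i).
  by rewrite (partials_pmean sigmaS _ RF_coord_pmean wfU_hexp Up).
have DE : partial ord_max (RF_coord sigma F) p =
    pmean F sigma (dv (dir R 10) (hexp R k d)) p.
  have := partials_pmean sigmaS [:: ord_max] RF_coord_pmean wfU_hexp Up.
  by rewrite /= /pidx eqxx.
rewrite (hyp_laplacianE LE DE) /L /pmean.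
have gd e : wfU F e -> good (fun v => ev (penv F p v) e).
  by move=> we; apply: (good_ev (admissible_penv F p)) => v Sv; exact: we.
rewrite mean_combination; try by apply: gd; do ?apply: wfU_dv; exact: wfU_hexp.
apply: mean_ge0 => v /sphere_neq0 v0.
apply: (@hexp_lap_ge0 R k d (penv F p v)) => //; first exact: ltnW.
- by rewrite ev_Aexp0 Aval_gt0.
- by rewrite ev_Aexp4 Aval_gt0// F_neq0.
- by move=> kR; rewrite /penv /= !Kim_realbase.
Qed.

(** The argument of the logarithm is rho^2 = 2 cosh of the hyperbolic distance from p to (0, 1), so
    the bound grows linearly with that distance. *)
Lemma RF_lower_bound : exists C : R, forall p, U p ->
  ln (tcoord p + (Kre (zcoord p) ^+ 2 + Kim (zcoord p) ^+ 2) / tcoord p + (tcoord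
      p)^-1) / 10 - C
  <= RF_coord sigma F p.
Proof.
have [C hC] := mean_lift_lower_bound sigma_inv F1 F2 F_neq0 d2; exists C => p Up.
pose s := Num.sqrt (tcoord p); have s0 : 0 < s by rewrite sqrtr_gt0.
have sn0 : s != 0 by rewrite gt_eqF.
have sk0 : Kreal k s != 0 by rewrite Kreal_eq0.
have ss : s ^+ 2 = tcoord p by rewrite sqr_sqrtr// ltW.
have := hC s (zcoord p / Kreal k s) s0; lazy zeta.
have [_ ->] := mean_lift sigma_inv F1 F2 F_neq0 (zcoord p / Kreal k s) s0.
rewrite divfK// ss -(RF_coordE sigma_inv F1 F2 F_neq0 Up).
rewrite (_ : hs_sqr s _ = tcoord p + (Kre (zcoord p) ^+ 2 + Kim (zcoord p) ^+ 2) /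
    tcoord p + (tcoord p)^-1)//.
by rewrite /hs_sqr -KrealV KreM KimM Kre_real Kim_real -ss; field.
Qed.

(** The lower bound on t keeps the box away from the boundary: it is compact in the ambient space
    and lies inside [U]. *)
Definition box (B : R) : set P :=
  [set p | forall i, p 0 i \in if i == ord_max then `[B^-1, B] else `[- B, B]].

Lemma compact_box B : compact (box B).
Proof.
pose A (i : 'I_(Kdeg k).+1) : set R := [set` if i == ord_max then `[B^-1, B]
    else `[- B, B]].
have cA i : compact (A i) by rewrite /A; case: ifP => _; exact: segment_compact.
exact: (rV_compact cA).
Qed.

Lemma box_sub B : 0 < B -> box B `<=` U.
Proof.
move=> B0 p /(_ ord_max); rewrite eqxx in_itv/= => /andP[h _].
by apply: lt_le_trans h; rewrite invr_gt0.
Qed.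

(** The lower bound gives rho^2 <= B for B = exp(10 (M + C)). Its three summands are nonnegative,
    hence t <= B, 1/t <= B and |z|^2 <= B t <= B^2. *)
Lemma RF_sublevel (M : R) : exists2 B : R, 0 < B &
  forall p, U p -> RF_coord sigma F p <= M -> box B p.
Proof.
have [C hC] := RF_lower_bound; pose B := expR (10 * (M + C)).
have B0 : 0 < B by rewrite expR_gt0.
exists B => // p Up RM; have t0 : 0 < tcoord p := Up.
have := le_trans (hC p Up) RM.
set t := tcoord p in t0 *; set z2 := Kre _ ^+ 2 + _ => h.
have z20 : 0 <= z2 by rewrite /z2 addr_ge0 ?sqr_ge0.
have zt0 : 0 <= z2 / t by rewrite divr_ge0// ltW.
have ti0 : 0 < t^-1 by rewrite invr_gt0.
have rB : t + z2 / t + t^-1 <= B.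
  rewrite /B -[leLHS]lnK ?posrE; last by rewrite ltr_wpDl ?addr_ge0// ltW.
  by rewrite ler_expR; lra.
have tB : t <= B by lra.
have tiB : B^-1 <= t by rewrite -[leRHS]invrK lef_pV2 ?posrE//; lra.
have zB : z2 <= B ^+ 2.
  have : z2 / t <= B by lra.
  rewrite ler_pdivrMr// => h2; apply: (le_trans h2).
  by rewrite expr2 ler_wpM2l// ltW.
have zb (x : R) : x ^+ 2 <= z2 -> x \in `[- B, B].
  move=> xz; rewrite in_itv/= -ler_norml -ler_sqr ?nnegrE ?(ltW B0)//.
  by rewrite real_normK ?num_real//; exact: le_trans xz zB.
move=> i; case: ifPn => [/eqP ->|]; first by rewrite in_itv/= -/(tcoord p) tiB tB.
by move=> ni; apply: zb; exact: coord_sqr_le.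
Qed.

Lemma gamma_SL2 (p : P) : U p -> SL2 (gamma_mx p).
Proof.
move=> t0; rewrite gamma_mxE /SL2 /= det_mx2 !mxE /= mulr0 subr0 -KrealM divff ?Kreal1//.
by rewrite gt_eqF// sqrtr_gt0.
Qed.

(** Limit points of the preimage, taken in the ambient space, stay in a box and hence in [U], where
    continuity and the closedness of [A] apply. *)
Lemma RF_proper : proper_on U (RF_coord sigma F).
Proof.
move=> A cA.
have [M AM] : exists M, forall x, A x -> x <= M.
  have /compact_bounded[M [_ hM]] := cA; exists (M + 1) => x Ax.
  by apply: le_trans (ler_norm _) (hM (M + 1) _ _ Ax); rewrite ltrDl.
have [B B0 sB] := RF_sublevel M.
have XB : U `&` RF_coord sigma F @^-1` A `<=` box B.
  by move=> p [Up /= Ap]; apply: sB => //; exact: AM.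
apply: (subclosed_compact _ (@compact_box B) XB).
move=> q clq; have qB : box B q.
  have : closed (box B) by apply: compact_closed;
      [exact: norm_hausdorff|exact: compact_box].
  by apply; apply: closure_subset clq.
have Uq : U q by exact: box_sub qB.
split=> //; have cA' : closed A by apply: compact_closed => //; exact: Rhausdorff.
apply: cA' => N nN; have := clq _ (RF_continuous Uq nN).
by case=> x [[_ Ax] Nx]; exists (RF_coord sigma F x).
Qed.

(** The minimum is taken over a box containing the sublevel set of the value at (0, 1); points
    outside have larger values, and [iwasawa] reaches every coset from a point of [U]. *)
Lemma RF_min : exists2 c, @hspace R k c &
  forall c', @hspace R k c' -> RF sigma F c <= RF sigma F c'.
Proof.
have [p0 [_ t1]] := coord_surj (0 : K) (1 : R).
have Up0 : U p0 by rewrite /upper_half /= t1.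
have [B B0 sB] := RF_sublevel (RF_coord sigma F p0).
have c0 : {within box B, continuous (RF_coord sigma F)}.
  apply: continuous_in_subspaceT => q /set_mem qB; apply: RF_continuous; exact: box_sub qB.
have ne : box B !=set0 by exists p0; exact: sB.
have [c /set_mem cB cmin] := compact_EVT_min ne (@compact_box B) c0.
have Uc : U c by exact: box_sub cB.
exists (SU2_coset (gamma_mx c)); first by exists (gamma_mx c) => //; exact: gamma_SL2.
move=> _ [g sg <-]; have [p Up ->] := iwasawa sg.
rewrite -/(RF_coord sigma F c) -/(RF_coord sigma F p).
have /orP[le|ge] := le_total (RF_coord sigma F p) (RF_coord sigma F p0).
  by apply: cmin; apply: mem_set; exact: sB.
by apply: le_trans ge; apply: cmin; apply: mem_set; exact: sB.
Qed.

End MainProof.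

Theorem theorem1p0p1 (R : realType) (k : base)
    (f : {fraction {poly Kfield R k}}) (d : nat)
    (F : bipoly (Kfield R k) * bipoly (Kfield R k))
    (sigma : probability (Kborel R k) R) :
  (2 <= d)%N ->
  has_degree f d ->
  homogeneous_lift f d F ->
  rotation_invariant sigma ->
  [/\ smooth_on (@upper_half R k) (RF_coord sigma F),
      proper_on (@upper_half R k) (RF_coord sigma F),
      (forall p, @upper_half R k p -> 0 <= hyp_laplacian (RF_coord sigma F) p) &
      exists2 c, @hspace R k c &
        forall c', @hspace R k c' -> RF sigma F c <= RF sigma F c'].
Proof.
move=> d2 fd Ff si; have [F1 F2 _ _] := Ff.
have F0 v : v != 0 -> lift_map F v != 0 by exact: (lift_map_neq0 d2 fd Ff).
split.
- exact: (RF_smooth si F1 F2 F0).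
- exact: (RF_proper si F1 F2 F0 d2).
- by move=> p Up; exact: (RF_subharmonic si F1 F2 F0 d2 Up).
- exact: (RF_min si F1 F2 F0 d2).
Qed.
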